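(* Let $n\geq 1$ and let $p\in\mathbb{R}$ with $p\leq 1$. Then the power-Wasserstein metric of parameter $p$ on $\mathrm{SPD}(n)$ is a mean kernel metric.
   Context: $\mathrm{Sym}(n)$ is the space of real symmetric $n\times n$ matrices, $\mathrm{SPD}(n)\subset\mathrm{Sym}(n)$ the manifold of symmetric positive definite matrices, so $T_\Sigma\mathrm{SPD}(n)\simeq\mathrm{Sym}(n)$; $\mathrm{O}(n)$ is the orthogonal group. The Bures-Wasserstein metric on $\mathrm{SPD}(n)$ is $g^{\mathrm{BW}}_\Sigma(X,X)=\mathrm{tr}(\Sigma\,\mathcal{S}_\Sigma(X)^2)$, where $\mathcal{S}_\Sigma(X)\in\mathrm{Sym}(n)$ is the solution of the Sylvester equation $X=\Sigma\,\mathcal{S}_\Sigma(X)+\mathcal{S}_\Sigma(X)\,\Sigma$. For $p\neq 0$, let $\mathrm{pow}_p:\mathrm{SPD}(n)\to\mathrm{SPD}(n)$, $\Sigma\mapsto\Sigma^p$. The power-Wasserstein metric of parameter $p\neq 0$ is $\frac{1}{p^2}\,\mathrm{pow}_p^*g^{\mathrm{BW}}$, i.e. $g_\Sigma(X,X)=\frac{1}{p^2}\,g^{\mathrm{BW}}_{\Sigma^p}(d_\Sigma\mathrm{pow}_p(X),d_\Sigma\mathrm{pow}_p(X))$. For $p=0$, the power-Wasserstein metric is the log-Euclidean metric associated with the inner product $g^{\mathrm{BW}}_{I_n}$ (the limit as $p\to 0$ of the metrics $\frac{1}{p^2}\,\mathrm{pow}_p^*g^{\mathrm{BW}}$, $p\neq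 0$), i.e. $g_\Sigma(X,X)=g^{\mathrm{BW}}_{I_n}(d_\Sigma\log(X),d_\Sigma\log(X))$, where $\log:\mathrm{SPD}(n)\to\mathrm{Sym}(n)$ is the symmetric matrix logarithm. A kernel metric is an $\mathrm{O}(n)$-invariant Riemannian metric $g$ on $\mathrm{SPD}(n)$ for which there is a smooth symmetric map $\phi:(0,\infty)^2\to(0,\infty)$ such that $g_\Sigma(X,X)=\sum_{i,j}\frac{1}{\phi(d_i,d_j)}(X'_{ij})^2$ whenever $\Sigma=PDP^\top$, $X=PX'P^\top$ with $P\in\mathrm{O}(n)$ and $D=\mathrm{Diag}(d_1,\dots,d_n)$. A mean kernel metric is a kernel metric whose map $\phi$ can be taken of the form $\phi(x,y)=a\,m(x,y)^\theta$ with $a>0$, $\theta\in\mathbb{R}$ and $m:(0,\infty)^2\to(0,\infty)$ a symmetric homogeneous mean, that is: (1) $m(x,y)=m(y,x)$; (2) $m(cx,cy)=c\,m(x,y)$ for all $c,x,y>0$; (3) $m$ is non-decreasing in both variables; (4) $\min(x,y)\leq m(x,y)\leq\max(x,y)$ for all $x,y>0$. *)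

(* Defs.v *)
From HB Require Import structures.
From mathcomp Require Import all_boot all_order all_algebra.
From mathcomp Require Import all_classical all_reals all_analysis.

Set Implicit Arguments.
Unset Strict Implicit.
Unset Printing Implicit Defensive.

Import Order.TTheory GRing.Theory Num.Theory.
Import numFieldNormedType.Exports.

Local Open Scope classical_set_scope.
Local Open Scope ring_scope.

Definition Sym (R : realType) (n : nat) : set 'M[R]_n := [set X | X^T = X].

Definition SPD (R : realType) (n : nat) : set 'M[R]_n :=
  [set S | S^T = S /\
    forall x : 'cV[R]_n, x != 0 -> 0 < (x^T *m S *m x) ord0 ord0].

Definition Orth (R : realType) (n : nat) : set 'M[R]_n :=
  [set P | P^T *m P = 1%:M].

(* [U] is meant to be a relatively open subset of the linear subspace [E] of
   the finite-dimensional space [V]: [f] is C^k on [U] when its iterated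
   derivatives of order at most [k] along vectors of [E] exist and are
   continuous on [U].  For x in [U] and v in [E], ['D_v f x] only depends on
   the values of [f] on [U]. *)
Fixpoint class_C (R : realType) (V W : normedModType R) (E U : set V)
    (k : nat) (f : V -> W) : Prop :=
  {within U, continuous f} /\
  (if k is k'.+1 then
     forall v, E v ->
       (forall x, U x -> derivable f x v) /\ class_C E U k' ('D_v f)
   else True).

Definition smooth_on (R : realType) (V W : normedModType R) (E U : set V)
    (f : V -> W) : Prop :=
  forall k, class_C E U k f.

(* P diag(d) P^T |-> P diag(f d) P^T, for P orthogonal; the result does not
   depend on the chosen diagonalization, and is 0 when there is none. *)
Definition spectral_fun (R : realType) (n : nat) (f : R -> R) (S : 'M[R]_n) :
    'M[R]_n :=
  xget 0 [set Y | exists (P : 'M[R]_n) (d : 'rV[R]_n),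
    [/\ Orth P, S = P *m diag_mx d *m P^T &
        Y = P *m diag_mx (map_mx f d) *m P^T]].

Definition mxpow (R : realType) (n : nat) (p : R) : 'M[R]_n -> 'M[R]_n :=
  spectral_fun (fun x => x `^ p).

Definition mxlog (R : realType) (n : nat) : 'M[R]_n -> 'M[R]_n :=
  spectral_fun (@ln R).

Definition sylvester (R : realType) (n : nat) (S X : 'M[R]_n) : 'M[R]_n :=
  xget 0 [set Y | Sym Y /\ X = S *m Y + Y *m S].

(* A field of bilinear forms: [g S X Y] is the value at the point [S] on the
   tangent vectors [X] and [Y]; only [S] in SPD(n) and [X], [Y] in Sym(n) are
   relevant. *)
Definition metric_field (R : realType) (n : nat) : Type :=
  'M[R]_n -> 'M[R]_n -> 'M[R]_n -> R.

(* The bilinear form polarizing X |-> tr (S * (sylvester S X)^2). *)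
Definition bures_wasserstein (R : realType) (n : nat) : metric_field R n :=
  fun S X Y => \tr (S *m (sylvester S X *m sylvester S Y)).

(* Tangent vectors being symmetric matrices, the differential of a map on
   SPD(n) at S applied to X is the derivative at S along the line S + t X.
   (The Frechet differential ['d] on all of 'M[R]_n would not be appropriate,
   as SPD(n) is not open there.) *)
Definition power_wasserstein (R : realType) (n : nat) (p : R) :
    metric_field R n :=
  fun S X Y =>
    if p == 0 then
      bures_wasserstein 1%:M ('D_X (@mxlog R n) S) ('D_Y (@mxlog R n) S)
    else
      1 / p ^+ 2 *
      bures_wasserstein (mxpow p S) ('D_X (@mxpow R n p) S)
                                    ('D_Y (@mxpow R n p) S).

Definition riemannian_metric (R : realType) (n : nat) (g : metric_field R n) :
    Prop :=
  [/\ forall S X Y, SPD S -> Sym X -> Sym Y -> g S X Y = g S Y X,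
      forall S (a : R) X Y Z, SPD S -> Sym X -> Sym Y -> Sym Z ->
        g S (a *: X + Y) Z = a * g S X Z + g S Y Z,
      forall S X, SPD S -> Sym X -> X != 0 -> 0 < g S X X &
      forall X Y, Sym X -> Sym Y ->
        smooth_on (@Sym R n) (@SPD R n) (fun S => g S X Y)].

Definition orth_invariant (R : realType) (n : nat) (g : metric_field R n) :
    Prop :=
  forall P S X Y : 'M[R]_n, Orth P -> SPD S -> Sym X -> Sym Y ->
    g (P *m S *m P^T) (P *m X *m P^T) (P *m Y *m P^T) = g S X Y.

Definition pos_quadrant (R : realType) : set (R * R) :=
  [set z | 0 < z.1 /\ 0 < z.2].

(* Only the values of [phi] on positive arguments are relevant. *)
Definition kernel_map (R : realType) (phi : R -> R -> R) : Prop :=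
  [/\ forall x y : R, 0 < x -> 0 < y -> 0 < phi x y,
      forall x y : R, 0 < x -> 0 < y -> phi x y = phi y x &
      smooth_on setT (@pos_quadrant R) (fun z : R * R => phi z.1 z.2)].

Definition has_kernel (R : realType) (n : nat) (g : metric_field R n)
    (phi : R -> R -> R) : Prop :=
  forall (S X P X' : 'M[R]_n) (d : 'rV[R]_n),
    SPD S -> Sym X -> Orth P ->
    S = P *m diag_mx d *m P^T -> X = P *m X' *m P^T ->
    g S X X = \sum_(i < n) \sum_(j < n)
      1 / phi (d ord0 i) (d ord0 j) * X' i j ^+ 2.

Definition symmetric_homogeneous_mean (R : realType) (m : R -> R -> R) : Prop :=
  (forall x y : R, 0 < x -> 0 < y -> 0 < m x y) /\
  [/\ forall x y : R, 0 < x -> 0 < y -> m x y = m y x,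
      forall c x y : R, 0 < c -> 0 < x -> 0 < y -> m (c * x) (c * y) = c * m x y,
      forall x x' y y' : R, 0 < x -> 0 < y -> x <= x' -> y <= y' ->
        m x y <= m x' y' &
      forall x y : R, 0 < x -> 0 < y -> Num.min x y <= m x y <= Num.max x y].

Definition mean_form (R : realType) (phi : R -> R -> R) : Prop :=
  exists (a theta : R) (m : R -> R -> R),
    [/\ 0 < a, symmetric_homogeneous_mean m &
        forall x y : R, 0 < x -> 0 < y -> phi x y = a * m x y `^ theta].

Definition kernel_metric (R : realType) (n : nat) (g : metric_field R n) :
    Prop :=
  [/\ riemannian_metric g, orth_invariant g &
      exists phi, kernel_map phi /\ has_kernel g phi].

Definition mean_kernel_metric (R : realType) (n : nat) (g : metric_field R n) :
    Prop :=
  kernel_metric g /\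
  exists phi, [/\ kernel_map phi, has_kernel g phi & mean_form phi].

(* Main.v *)
From HB Require Import structures.
Require Import Defs.
From mathcomp Require Import all_boot all_order all_algebra.
From mathcomp Require Import all_classical all_reals all_analysis.
From mathcomp Require Import ring lra.
From mathcomp Require Import complex spectral sesquilinear.
Import Order.TTheory GRing.Theory Num.Theory.
Import numFieldNormedType.Exports.
Local Open Scope classical_set_scope.
Local Open Scope ring_scope.
Set Implicit Arguments.
Unset Strict Implicit.
Unset Printing Implicit Defensive.

(** In an eigenbasis of S, with eigenvalues d_i, the differential of a spectral
    function f multiplies the (i, j) entry by the divided difference of f at
    (d_i, d_j), and solving the Sylvester equation divides it by d_i + d_j.
    The power-Wasserstein metric is therefore diagonal there, with kernel

      phi(x, y) = 2 (x^p + y^p) / q(x, y)^2,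
      q(x, y) = (x^p - y^p) / (p (x - y)),

    where q is read as (ln x - ln y) / (x - y) for p = 0, and by continuity on
    the diagonal ([power_wasserstein_spectral]).  Symmetry, bilinearity,
    positivity and orthogonal invariance of the metric are read off this sum.

    _Mean form_ ([pw_kernel_mean_form]).  The kernel is homogeneous of degree
    2 - p > 0 and equals 4 x^(2-p) at (x, x), so m = (phi / 4)^(1 / (2 - p)) is
    a mean as soon as phi is nondecreasing in x; the bounds by min and max come
    from comparing (x, y) with the two diagonal points.  Now q(., y) is the
    slope of a primitive of t^(p-1), which is concave because p <= 1, so q
    is nonincreasing.  For p >= 0 the factor x^p + y^p is nondecreasing and this
    is enough.  For p < 0 that factor decreases, and phi is factored differently
    on the two sides of the diagonal, again around slopes of concave functions.

    _Smoothness_.  Let E be the divided difference of the exponential.  Then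
    q(x, y) = E(p ln x, p ln y) / E(ln x, ln y) for every p, including 0 and the
    diagonal, so everything reduces to exp and log.
    - The exponential of the block matrix [[A, Z], [0, B]] has the upper right
      block exp A - exp B when Z = A - B, and this block is homogeneous in Z.
      A difference quotient of exp is thus a block of exp in twice the dimension:
      continuity of exp in all dimensions already gives its derivative, again as
      a block of an exponential, and C^k follows for every k by induction over
      all dimensions at once ([class_C_mexp]).
    - For the logarithm, subtracting exp (log T) = T and exp (log S) = S
      gives an invertible linear equation for the difference quotient of log,
      whose coefficients depend smoothly on log S and log T.  Cramer's rule
      ([class_C_linear_solve]) turns continuity of log into differentiability,
      and then C^k into C^(k+1) ([class_C_mxlog]).  Continuity itself is an
      entrywise Lipschitz estimate ([spectral_lipschitz]).
    - S^p = exp (p log S), and the Sylvester solution is again a Cramer solution.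
      The same block exponential, for 1 x 1 blocks, shows that E, hence phi, is
      smooth. *)

(** * Calculus of class C^k along a subspace *)

(** The only openness that derivatives along E see.  The positive definite
    matrices are not open among all matrices, but they are in this sense along
    the symmetric ones. *)
Definition dir_open (R : realType) (V : normedModType R) (E U : set V) :=
  forall x v, U x -> E v -> \forall h \near (0 : R)^', U (h *: v + x).

Lemma cvg_mx (R : realType) (T : Type) (F : set_system T) (FF : Filter F) m n
    (f : T -> 'M[R]_(m, n)) (l : 'M[R]_(m, n)) :
  (forall i j, f t i j @[t --> F] --> l i j) -> f @ F --> l.
Proof.
move=> H; apply/cvgrPdist_lt => /= e e0.
have : \forall t \near F, forall ij : 'I_m * 'I_n,
    `|l ij.1 ij.2 - f t ij.1 ij.2| < e.
  by apply: filter_forall => -[i j] /=; have /cvgrPdist_lt := H i j; exact.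
apply: filterS => t Ht.
rewrite /Num.Def.normr/= mx_normrE (bigmax_lt _ e0)//= => -[i j] _.
by rewrite !mxE; exact: (Ht (i, j)).
Qed.

Section ClassC.
Context (R : realType) (V : normedModType R) (E U : set V).
Hypothesis Uopen : dir_open E U.
Implicit Type W : normedModType R.

Lemma class_C_continuous W k (f : V -> W) :
  class_C E U k f -> {within U, continuous f}.
Proof. by case: k => [|k] []. Qed.

Lemma class_C_derivable W k (f : V -> W) x v :
  class_C E U k.+1 f -> U x -> E v -> derivable f x v.
Proof. by case=> _ H Ux Ev; case: (H v Ev) => H1 _; exact: H1. Qed.

Lemma class_C_derive W k (f : V -> W) v :
  class_C E U k.+1 f -> E v -> class_C E U k ('D_v f).
Proof. by case=> _ H Ev; case: (H v Ev). Qed.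

Lemma class_CW W k (f : V -> W) : class_C E U k.+1 f -> class_C E U k f.
Proof.
elim: k f => [|k IH] f [fc fd]; first by split.
split=> // v Ev; case: (fd v Ev) => f1 f2; split=> //; exact: IH.
Qed.

(** Derivatives along E at a point of U only see the values on U, so functions
    specified only there, such as the matrix logarithm, may be rewritten. *)
Lemma is_derive_ext W (f g : V -> W) x v l :
  U x -> E v -> (forall y, U y -> f y = g y) ->
  is_derive x v f l -> is_derive x v g l.
Proof.
move=> Ux Ev fg [df <-].
have H : \forall h \near (0:R)^',
    h^-1 *: ((f \o shift x) (h *: v) - f x) =
    h^-1 *: ((g \o shift x) (h *: v) - g x).
  have := Uopen Ux Ev; apply: filterS => h Uh.
  by rewrite /= !fg.
have gl : (fun h => h^-1 *: ((g \o shift x) (h *: v) - g x)) @ (0:R)^' -->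
    'D_v f x.
  exact: cvg_trans (near_eq_cvg H) df.
by split; [exact: cvgP gl | exact: cvg_lim gl].
Qed.

Lemma class_C_ext W k (f g : V -> W) : (forall y, U y -> f y = g y) ->
  class_C E U k f -> class_C E U k g.
Proof.
elim: k f g => [|k IH] f g fg [fc fd].
  by split=> //; apply: subspace_eq_continuous fc => x /set_mem /fg.
split; first by apply: subspace_eq_continuous fc => x /set_mem /fg.
move=> v Ev; case: (fd v Ev) => f1 f2.
have D x : U x -> is_derive x v g ('D_v f x).
  by move=> Ux; apply: (is_derive_ext Ux Ev fg); exact/derivableP/f1.
split=> [x /D []//|].
by apply: IH f2 => x /D [_ ->].
Qed.

Lemma class_CS W k (f : V -> W) : {within U, continuous f} ->
  (forall v, E v -> exists2 g, class_C E U k g &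
     forall x, U x -> is_derive x v f (g x)) ->
  class_C E U k.+1 f.
Proof.
move=> fc fd; split=> // v Ev; case: (fd v Ev) => g gk gd.
split=> [x /gd []//|].
by apply: class_C_ext gk => x /gd [].
Qed.

Lemma class_C_cst W k (a : W) : class_C E U k (fun=> a).
Proof.
elim: k a => [|k IH] a.
  by split=> //; apply: continuous_subspaceT => x; exact: cvg_cst.
apply: class_CS => [|v Ev].
  by apply: continuous_subspaceT => x; exact: cvg_cst.
exists (fun=> 0) => // x Ux; exact: is_derive_cst.
Qed.

Lemma class_CD W k (f g : V -> W) : class_C E U k f -> class_C E U k g ->
  class_C E U k (fun x => f x + g x).
Proof.
have C0 (f' g' : V -> W) :
    {within U, continuous f'} -> {within U, continuous g'} ->
    {within U, continuous (fun x => f' x + g' x : W)}.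
  by move=> fc gc x; apply: cvgD; [exact: fc|exact: gc].
elim: k f g => [|k IH] f g fk gk.
  by split=> //; apply: C0; [case: fk | case: gk].
apply: class_CS => [|v Ev].
  by apply: C0; [case: fk | case: gk].
exists (fun x => 'D_v f x + 'D_v g x).
  by apply: IH; apply: class_C_derive.
move=> x Ux; apply: is_deriveD; apply: derivableP;
  [exact: class_C_derivable fk Ux Ev|exact: class_C_derivable gk Ux Ev].
Qed.

Lemma class_C_sum W k I (r : seq I) (P : pred I) (f : I -> V -> W) :
  (forall i, P i -> class_C E U k (f i)) ->
  class_C E U k (fun x => \sum_(i <- r | P i) f i x).
Proof.
move=> H; elim: r => [|i r IH].
  by apply: class_C_ext (class_C_cst k 0) => x _; rewrite big_nil.
case Pi : (P i).
  apply: class_C_ext (class_CD (H i Pi) IH) => x _.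
  by rewrite big_cons Pi.
by apply: class_C_ext IH => x _; rewrite big_cons Pi.
Qed.

Lemma class_CM k (f g : V -> R) : class_C E U k f -> class_C E U k g ->
  class_C E U k (fun x => f x * g x).
Proof.
have C0 (f' g' : V -> R) :
    {within U, continuous f'} -> {within U, continuous g'} ->
    {within U, continuous (fun x => f' x * g' x : R)}.
  by move=> fc gc x; apply: cvgM; [exact: fc|exact: gc].
elim: k f g => [|k IH] f g fk gk.
  by split=> //; apply: C0; [case: fk | case: gk].
apply: class_CS => [|v Ev].
  by apply: C0; [case: fk | case: gk].
exists (fun x => f x * 'D_v g x + g x * 'D_v f x).
  by apply: class_CD; apply: IH; (try exact: class_CW); apply: class_C_derive.
move=> x Ux; apply: is_deriveM; apply: derivableP;
  [exact: class_C_derivable fk Ux Ev|exact: class_C_derivable gk Ux Ev].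
Qed.

Lemma class_C_prod k I (r : seq I) (P : pred I) (f : I -> V -> R) :
  (forall i, P i -> class_C E U k (f i)) ->
  class_C E U k (fun x => \prod_(i <- r | P i) f i x).
Proof.
move=> H; elim: r => [|i r IH].
  by apply: class_C_ext (class_C_cst k (1 : R)) => x _; rewrite big_nil.
case Pi : (P i).
  apply: class_C_ext (class_CM (H i Pi) IH) => x _.
  by rewrite big_cons Pi.
by apply: class_C_ext IH => x _; rewrite big_cons Pi.
Qed.

Lemma class_CV k (f : V -> R) : class_C E U k f ->
  (forall x, U x -> f x != 0) -> class_C E U k (fun x => (f x)^-1).
Proof.
move=> fk f0; have fc := class_C_continuous fk.
have C0 : {within U, continuous (fun x => (f x)^-1)}.
  apply/subspace_continuousP => x Ux; apply: cvgV; first exact: f0.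
  by move/subspace_continuousP: fc; exact.
elim: k fk => [|k IH] fk; first by split.
apply: class_CS => // v Ev.
exists (fun x => - 1 * ((f x)^-1 * (f x)^-1 * 'D_v f x)).
  apply: class_CM; first exact: class_C_cst.
  apply: class_CM; last exact: class_C_derive.
  by apply: class_CM; apply: IH; exact: class_CW.
move=> x Ux; have df := class_C_derivable fk Ux Ev.
split; first by apply: derivableV => //; exact: f0.
rewrite deriveV//; last exact: f0.
by rewrite /GRing.scale /= -exprVn expr2 mulN1r mulNr.
Qed.

Lemma class_C_mx k m n (F : V -> 'M[R]_(m, n)) :
  (forall i j, class_C E U k (fun x => F x i j)) <-> class_C E U k F.
Proof.
have C0 (F' : V -> 'M[R]_(m, n)) :
    (forall i j, {within U, continuous (fun x => F' x i j)}) <->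
    {within U, continuous F'}.
  split=> Fc.
    apply/subspace_continuousP => x Ux; apply: cvg_mx => i j.
    by have /subspace_continuousP/(_ x Ux) := Fc i j.
  move=> i j x.
  exact: (continuous_comp (Fc x) (@coord_continuous R _ _ i j (F' x))).
elim: k F => [|k IH] F.
  split=> [H|[H _]].
    by split=> //; apply: (C0 F).1 => i j; case: (H i j).
  by move=> i j; split=> //; apply: (C0 F).2.
split=> H.
  apply: class_CS => [|v Ev]; first by apply: (C0 F).1 => i j; case: (H i j).
  exists (fun x => \matrix_(i, j) 'D_v (fun t => F t i j) x).
    apply/IH => i j.
    have : class_C E U k ('D_v (fun t => F t i j)) by exact: class_C_derive.
    by apply: class_C_ext => x _; rewrite mxE.
  move=> x Ux.
  have dF : derivable F x v.
    by apply/derivable_mxP => i j; exact: class_C_derivable (H i j) Ux Ev.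
  by split=> //; rewrite derive_mx.
move=> i j; apply: class_CS => [|v Ev].
  by apply: (C0 F).2; case: H.
exists (fun x => ('D_v F x) i j).
  by move: i j; apply/IH; apply: class_C_derive.
move=> x Ux; have dF := class_C_derivable H Ux Ev.
split; first by move/derivable_mxP: dF; exact.
by rewrite derive_mx// mxE.
Qed.

Lemma class_C_mulmx k m n p (F : V -> 'M[R]_(m, n)) (G : V -> 'M[R]_(n, p)) :
  class_C E U k F -> class_C E U k G -> class_C E U k (fun x => F x *m G x).
Proof.
move=> /class_C_mx HF /class_C_mx HG; apply/class_C_mx => i j.
have : class_C E U k (fun x => \sum_l F x i l * G x l j).
  by apply: class_C_sum => l _; apply: class_CM.
by apply: class_C_ext => x _; rewrite mxE.
Qed.

Lemma class_C_scalemx k m n (f : V -> R) (F : V -> 'M[R]_(m, n)) :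
  class_C E U k f -> class_C E U k F -> class_C E U k (fun x => f x *: F x).
Proof.
move=> Hf /class_C_mx HF; apply/class_C_mx => i j.
by apply: class_C_ext (class_CM Hf (HF i j)) => x _; rewrite mxE.
Qed.

Lemma class_C_block k m n (A : V -> 'M[R]_m) (B : V -> 'M[R]_(m, n))
    (C : V -> 'M[R]_(n, m)) (D : V -> 'M[R]_n) :
  class_C E U k A -> class_C E U k B -> class_C E U k C -> class_C E U k D ->
  class_C E U k (fun x => block_mx (A x) (B x) (C x) (D x)).
Proof.
move=> /class_C_mx HA /class_C_mx HB /class_C_mx HC /class_C_mx HD.
apply/class_C_mx => i j.
case: (split_ordP i) => i' ->; case: (split_ordP j) => j' ->.
- by apply: class_C_ext (HA i' j') => x _; rewrite block_mxEul.
- by apply: class_C_ext (HB i' j') => x _; rewrite block_mxEur.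
- by apply: class_C_ext (HC i' j') => x _; rewrite block_mxEdl.
- by apply: class_C_ext (HD i' j') => x _; rewrite block_mxEdr.
Qed.

Lemma class_C_mxtrace k m (F : V -> 'M[R]_m) :
  class_C E U k F -> class_C E U k (fun x => \tr (F x)).
Proof. by move=> /class_C_mx HF; apply: class_C_sum. Qed.

Lemma class_C_det k m (F : V -> 'M[R]_m) :
  class_C E U k F -> class_C E U k (fun x => \det (F x)).
Proof.
move=> /class_C_mx HF; apply: class_C_sum => s _.
by apply: class_CM; [exact: class_C_cst | exact: class_C_prod].
Qed.

Lemma class_C_invmx k m (F : V -> 'M[R]_m) : class_C E U k F ->
  (forall x, U x -> F x \in unitmx) -> class_C E U k (fun x => invmx (F x)).
Proof.
move=> HF unitF.
have : class_C E U k (fun x => (\det (F x))^-1 *: \adj (F x)).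
  apply: class_C_scalemx.
    apply: class_CV; first exact: class_C_det.
    by move=> x /unitF; rewrite unitmxE unitfE.
  apply/class_C_mx => i j.
  have : class_C E U k (fun x => (-1) ^+ (j + i) * \det (row' j (col' i (F x)))).
    apply: class_CM; first exact: class_C_cst.
    apply: class_C_det; apply/class_C_mx => i' j'.
    move/class_C_mx: HF => /(_ (lift j i') (lift i j')).
    by apply: class_C_ext => x _; rewrite !mxE.
  by apply: class_C_ext => x _; rewrite mxE.
by apply: class_C_ext => x Ux; rewrite /invmx unitF.
Qed.

(** Cramer's rule with parameters: the inverse of the matrix of the linear map
    f x is a rational function of its entries, so the solution is as regular
    as the data. *)
Lemma class_C_linear_solve k n (f : V -> 'M[R]_n -> 'M[R]_n)
    (z w : V -> 'M[R]_n) :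
  (forall Z, class_C E U k (fun x => f x Z)) -> class_C E U k w ->
  (forall x, U x -> linear (f x)) ->
  (forall x Z, U x -> f x Z = 0 -> Z = 0) ->
  (forall x, U x -> f x (z x) = w x) -> class_C E U k z.
Proof.
move=> Hf Hw linf injf fz.
pose N x : 'M[R]_(n * n) := lin_mx (f x).
have NE x Z : U x -> mxvec Z *m N x = mxvec (f x Z).
  move=> Ux.
  pose fL : {linear 'M[R]_n -> 'M[R]_n} := HB.pack (f x)
    (GRing.isLinear.Build _ _ _ _ (f x) (linf x Ux)).
  exact: (mul_vec_lin fL Z).
have Nunit x : U x -> N x \in unitmx.
  move=> Ux; rewrite -row_free_unit -kermx_eq0; apply/eqP/row_matrixP => i.
  rewrite row0; set u := row i _.
  have : u *m N x = 0 by rewrite -row_mul mulmx_ker row0.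
  rewrite -[u]vec_mxK NE// => /(congr1 vec_mx).
  by rewrite mxvecK linear0 => /(injf _ _ Ux) ->; rewrite linear0.
have HN : class_C E U k N.
  apply/class_C_mx => i j.
  have /class_C_mx := Hf (vec_mx (delta_mx 0 i)).
  case: (mxvec_indexP j) => a b /(_ a b).
  apply: class_C_ext => x Ux.
  have -> : N x i (mxvec_index a b) =
      (delta_mx (0 : 'I_1) i *m N x) 0 (mxvec_index a b).
    by rewrite -rowE [RHS]mxE.
  by rewrite -[delta_mx 0 i in RHS]vec_mxK NE// [RHS]mxvecE.
have Hvec m (F : V -> 'M[R]_n) : class_C E U m F ->
    class_C E U m (fun x => mxvec (F x)).
  move=> /class_C_mx HF; apply/class_C_mx => i j.
  case: (mxvec_indexP j) => a b.
  by apply: class_C_ext (HF a b) => x _; rewrite ord1 mxvecE.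
have H : class_C E U k (fun x => mxvec (w x) *m invmx (N x)).
  by apply: class_C_mulmx; [exact: Hvec | exact: class_C_invmx].
apply/class_C_mx => a b.
move/class_C_mx: H => /(_ 0 (mxvec_index a b)).
apply: class_C_ext => x Ux.
by rewrite -fz// -NE// mulmxK ?Nunit// mxvecE.
Qed.

End ClassC.

(** * The matrix exponential *)

(** Stated with a factor C so as to give both the convergence of the exponential
    series and, applied to a difference of two of them, its Lipschitz bound. *)
Lemma series_exp_dominated (R : realType) (u : R ^nat) (C M : R) : 0 <= M ->
  (forall k, `|u k| <= C * exp_coeff M k) ->
  cvgn (series u) /\ `|limn (series u)| <= C * expR M.
Proof.
move=> M0 uC.
have eM : cvgn (series (C *: exp_coeff M)).
  by apply: is_cvg_seriesZ; exact: is_cvg_series_exp_coeff.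
have nu : cvgn [normed series u].
  apply: series_le_cvg eM => [k|k|k]; first exact: normr_ge0.
    exact: le_trans (normr_ge0 _) (uC k).
  exact: uC k.
split; first exact: normed_cvg.
apply: le_trans (lim_series_norm nu) _.
have <- : limn (series (C *: exp_coeff M)) = C * expR M.
  by rewrite lim_seriesZ//; exact: is_cvg_series_exp_coeff.
exact: lim_series_le.
Qed.

Lemma le_mx_norm (R : realType) m n (A : 'M[R]_(m, n)) i j : `|A i j| <= `|A|.
Proof.
rewrite [leRHS]/Num.Def.normr/= mx_normrE.
exact: (le_bigmax _ (fun ij => `|A ij.1 ij.2|) (i, j)).
Qed.

Lemma mx_norm_le (R : realType) m n (A : 'M[R]_(m, n)) c : 0 <= c ->
  (forall i j, `|A i j| <= c) -> `|A| <= c.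
Proof.
move=> c0 H; rewrite /Num.Def.normr/= mx_normrE.
by apply: bigmax_le => // -[i j] _; exact: H.
Qed.

Section MatrixExp.
Context (R : realType).

Definition mexp_coeff n (A : 'M[R]_n) i j : R ^nat :=
  fun k => (A ^+ k) i j / k`!%:R.

(** Taken entrywise, so that only series of real numbers are involved. *)
Definition mexp n (A : 'M[R]_n) : 'M[R]_n :=
  \matrix_(i, j) limn (series (mexp_coeff A i j)).

Lemma sum_norm_le n (u v : 'I_n -> R) a b :
  (forall l, `|u l| <= a) -> (forall l, `|v l| <= b) ->
  `|\sum_l u l * v l| <= n%:R * a * b.
Proof.
move=> ua vb; apply: le_trans (ler_norm_sum _ _ _) _.
rewrite -mulrA -[n in n%:R](card_ord n) mulr_natl -sumr_const.
by apply: ler_sum => l _; rewrite normrM ler_pM.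
Qed.

Lemma mxpow_bound n (A : 'M[R]_n) c k i j : 0 <= c -> `|A| <= c ->
  `|(A ^+ k) i j| <= (n%:R * c) ^+ k.
Proof.
move=> c0 Ac; elim: k i j => [|k IH] i j.
  by rewrite !expr0 mxE; case: (i == j); rewrite ?normr1 ?normr0.
rewrite !exprS -mulmxE mxE; apply: sum_norm_le => // l.
exact: le_trans (le_mx_norm _ _ _) Ac.
Qed.

(** From A^(k+1) - B^(k+1) = A (A^k - B^k) + (A - B) B^k; the constant
    is not sharp, but geometric in k, which is what the exponential series
    can absorb. *)
Lemma mxpow_lipschitz n (A B : 'M[R]_n) c k i j : `|A| <= c -> `|B| <= c ->
  `|(A ^+ k - B ^+ k) i j| <= `|A - B| * (2 * (n%:R * (c + 1))) ^+ k.
Proof.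
move=> Ac Bc; have c0 : 0 <= c by exact: le_trans Ac.
set M := n%:R * (c + 1); set d := `|A - B|.
have d0 : 0 <= d by exact: normr_ge0.
have n0 : 0 <= n%:R :> R by exact: ler0n.
have nM : n%:R <= M by rewrite /M mulrDr mulr1 lerDr mulr_ge0.
have ncM : n%:R * c <= M by rewrite /M mulrDr mulr1 lerDl.
have M0 : 0 <= M by exact: le_trans nM.
elim: k i j => [|k IH] i j; first by rewrite !expr0 subrr mxE normr0 mulr1.
have -> : A ^+ k.+1 - B ^+ k.+1 = A *m (A ^+ k - B ^+ k) + (A - B) *m B ^+ k.
  by rewrite !exprS -!mulmxE mulmxBr mulmxBl addrA subrK.
rewrite mxE; apply: le_trans (ler_normD _ _) _.
have X0 : 0 <= (2 * M) ^+ k.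
  by apply: exprn_ge0; apply: mulr_ge0 => //; exact: ler0n.
have H1 : `|(A *m (A ^+ k - B ^+ k)) i j| <= M * (d * (2 * M) ^+ k).
  rewrite mxE; apply: (@le_trans _ _ (n%:R * c * (d * (2 * M) ^+ k))).
    by apply: sum_norm_le => // l; exact: le_trans (le_mx_norm _ _ _) Ac.
  by apply: ler_wpM2r => //; exact: mulr_ge0.
have H2 : `|((A - B) *m B ^+ k) i j| <= M * (d * (2 * M) ^+ k).
  rewrite mxE; apply: (@le_trans _ _ (n%:R * d * (2 * M) ^+ k)).
    apply: sum_norm_le => l; first exact: le_mx_norm.
    apply: le_trans (mxpow_bound _ _ _ c0 Bc) _.
    have M2 : M <= 2 * M by apply: ler_peMl => //; rewrite ler1n.
    apply: lerXn2r; rewrite ?nnegrE; first exact: mulr_ge0.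
      exact: le_trans M2.
    exact: le_trans ncM M2.
  by rewrite -mulrA; apply: ler_wpM2r => //; exact: mulr_ge0.
apply: le_trans (lerD H1 H2) _.
by rewrite exprS le_eqVlt; apply/orP; left; apply/eqP; ring.
Qed.

Lemma mexp_coeff_cvg n (A : 'M[R]_n) i j :
  series (mexp_coeff A i j) @ \oo --> mexp A i j.
Proof.
rewrite mxE.
have [||//] := @series_exp_dominated R (mexp_coeff A i j) 1 (n%:R * `|A|).
  by rewrite mulr_ge0.
move=> k; rewrite mul1r /mexp_coeff /exp_coeff /= normrM normfV normr_nat.
by rewrite ler_wpM2r ?invr_ge0// mxpow_bound.
Qed.

Lemma mexp_lipschitz n (A B : 'M[R]_n) c : `|A| <= c -> `|B| <= c ->
  `|mexp A - mexp B| <= `|A - B| * expR (2 * (n%:R * (c + 1))).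
Proof.
move=> Ac Bc; have c0 : 0 <= c by exact: le_trans Ac.
apply: mx_norm_le => [|i j]; first by rewrite mulr_ge0 ?expR_ge0.
have M0 : 0 <= 2 * (n%:R * (c + 1)) by rewrite !mulr_ge0// addr_ge0.
have [|_] := @series_exp_dominated R
  (mexp_coeff A i j - mexp_coeff B i j) `|A - B| _ M0.
  move=> k; rewrite /GRing.opp /GRing.add /mexp_coeff /exp_coeff /=.
  rewrite -mulrBl normrM normfV normr_nat mulrA ler_wpM2r ?invr_ge0//.
  by have := mxpow_lipschitz k i j Ac Bc; rewrite !mxE.
have cA := @mexp_coeff_cvg n A i j; have cB := @mexp_coeff_cvg n B i j.
rewrite lim_seriesB; [|exact: cvgP cA|exact: cvgP cB].
by rewrite (cvg_lim _ cA)// (cvg_lim _ cB)// !mxE.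
Qed.

Lemma continuous_mexp n : continuous (@mexp n).
Proof.
move=> A; apply/(cvgrPdist_lt (FF := nbhs_filter A)) => e e0.
set K := expR (2 * (n%:R * (`|A| + 1 + 1))).
have K0 : 0 < K by exact: expR_gt0.
have r0 : 0 < Num.min 1 (e / K) by rewrite lt_min ltr01 divr_gt0.
have := nbhsx_ballx A _ r0; rewrite -ball_normE.
apply: (@filterS _ _ (nbhs_filter A)) => B BA.
move: BA; rewrite /= lt_min => /andP[BA1 BAe].
apply: (@le_lt_trans _ _ (`|A - B| * K)); last by rewrite -ltr_pdivlMr.
apply: mexp_lipschitz; first by rewrite lerDl.
rewrite -[B](subKr A); apply: le_trans (ler_normB _ _) _.
by rewrite lerD2l ltW.
Qed.

(** The one algebraic property of exp used below.  Since V may be rectangular,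
    it contains invariance under conjugation, the behaviour on block triangular
    matrices and the commutation of exp A with A. *)
Lemma mexp_intertwine m n (A : 'M[R]_m) (B : 'M[R]_n) (V : 'M[R]_(m, n)) :
  A *m V = V *m B -> mexp A *m V = V *m mexp B.
Proof.
move=> AV; have AVk k : A ^+ k *m V = V *m B ^+ k.
  elim: k => [|k IH]; first by rewrite !expr0 mulmx1 mul1mx.
  by rewrite !exprS -!mulmxE -mulmxA IH !mulmxA AV.
apply/matrixP => i j.
have HA : (fun N => \sum_l series (mexp_coeff A i l) N * V l j) @ \oo -->
    (mexp A *m V) i j.
  rewrite mxE; apply: cvg_big => [|l _]; first exact: add_continuous.
  by apply: cvgM; [exact: mexp_coeff_cvg|exact: cvg_cst].
have HB : (fun N => \sum_l V i l * series (mexp_coeff B l j) N) @ \oo -->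
    (V *m mexp B) i j.
  rewrite mxE; apply: cvg_big => [|l _]; first exact: add_continuous.
  by apply: cvgM; [exact: cvg_cst|exact: mexp_coeff_cvg].
suff E : (fun N => \sum_l series (mexp_coeff A i l) N * V l j) =
    (fun N => \sum_l V i l * series (mexp_coeff B l j) N).
  by rewrite E in HA; exact: (cvg_unique _ HA HB).
apply/funext => N; rewrite /series /=.
under eq_bigr do rewrite mulr_suml.
under [RHS]eq_bigr do rewrite mulr_sumr.
rewrite exchange_big [RHS]exchange_big /=; apply: eq_bigr => k _.
have := congr1 (fun M : 'M[R]_(m, n) => M i j / k`!%:R) (AVk k).
rewrite !mxE !mulr_suml /mexp_coeff => H.
under eq_bigr do rewrite mulrAC.
by rewrite H; apply: eq_bigr => l _; rewrite mulrA.
Qed.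

Lemma mexp_diag n (d : 'rV[R]_n) :
  mexp (diag_mx d) = diag_mx (map_mx (@expR R) d).
Proof.
have pk k : diag_mx d ^+ k = diag_mx (map_mx (fun x => x ^+ k) d).
  elim: k => [|k IH].
    by apply/matrixP => i j; rewrite expr0 !mxE expr0.
  rewrite exprS IH -mulmxE mul_diag_mx; apply/matrixP => i j; rewrite !mxE.
  by rewrite exprS; case: (i == j); rewrite ?mulr1n ?mulr0n ?mulr0.
apply/matrixP => i j; rewrite !mxE.
have [->|ij] := eqVneq i j.
  rewrite mulr1n /expR; congr (limn (series _)); apply/funext => k.
  by rewrite /mexp_coeff pk !mxE eqxx.
have -> : mexp_coeff (diag_mx d) i j = (fun=> 0).
  by apply/funext => k; rewrite /mexp_coeff pk !mxE (negbTE ij) mul0r.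
rewrite mulr0n; apply: cvg_lim => //.
rewrite (_ : series _ = fun=> 0); first exact: cvg_cst.
by apply/funext => N; rewrite /series /= big1.
Qed.

End MatrixExp.

Section DividedExp.
Context (R : realType).

Lemma mexp_conj n (P Q A : 'M[R]_n) : P *m Q = 1%:M ->
  mexp (P *m A *m Q) = P *m mexp A *m Q.
Proof.
move=> PQ; have QP := mulmx1C PQ.
rewrite -(@mexp_intertwine _ _ _ (P *m A *m Q)).
  by rewrite -[RHS]mulmxA PQ mulmx1.
by rewrite -!mulmxA QP mulmx1.
Qed.

(** The divided difference of exp at the pair (A, B), as a linear map in Z:
    for A = B it is the differential of exp at A, and [mexpB] is the
    defining property of a divided difference. *)
Definition dexp n (A B Z : 'M[R]_n) : 'M[R]_n :=
  ursubmx (mexp (block_mx A Z 0 B)).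

Lemma mexp_block n (A B Z : 'M[R]_n) :
  mexp (block_mx A Z 0 B) = block_mx (mexp A) (dexp A B Z) 0 (mexp B).
Proof.
set T := block_mx A Z 0 B.
have H1 : mexp T *m col_mx 1%:M 0 = col_mx 1%:M 0 *m mexp A.
  apply: mexp_intertwine; rewrite mul_block_col mul_col_mx.
  by rewrite !mulmx1 !mulmx0 mul1mx !mul0mx !addr0.
have H2 : mexp B *m row_mx 0 1%:M = row_mx 0 1%:M *m mexp T.
  apply: mexp_intertwine; rewrite mul_row_block mul_mx_row.
  by rewrite !mulmx1 !mulmx0 mul1mx !mul0mx !add0r.
move: H1 H2; rewrite -[mexp T]submxK mul_block_col mul_row_block.
rewrite mul_col_mx mul_mx_row !mulmx1 !mulmx0 !mul1mx !mul0mx !addr0 !add0r.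
by move=> /eq_col_mx[-> ->] /eq_row_mx[_ ->].
Qed.

(** The block matrix sends the column (-1, 1) to (-1, 1) B. *)
Lemma mexpB n (A B : 'M[R]_n) : mexp A - mexp B = dexp A B (A - B).
Proof.
have : mexp (block_mx A (A - B) 0 B) *m col_mx (- 1%:M) 1%:M =
    col_mx (- 1%:M) 1%:M *m mexp B.
  apply: mexp_intertwine; rewrite mul_block_col mul_col_mx.
  rewrite !mulmxN !mulmx1 mulNmx mul1mx oppr0 add0r addrA.
  by rewrite addNr add0r.
rewrite mexp_block mul_block_col mul_col_mx => /eq_col_mx[+ _].
rewrite mulmxN !mulmx1 mulNmx mul1mx => /eqP.
by rewrite addrC subr_eq => /eqP ->; rewrite addrC.
Qed.

Lemma dexpZ n (A B Z : 'M[R]_n) c : dexp A B (c *: Z) = c *: dexp A B Z.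
Proof.
have : mexp (block_mx A (c *: Z) 0 B) *m block_mx c%:M 0 0 1%:M =
    block_mx c%:M 0 0 1%:M *m mexp (block_mx A Z 0 B).
  apply: mexp_intertwine; rewrite !mulmx_block !mulmx0 !mul0mx !mulmx1 !mul1mx.
  by rewrite !addr0 !add0r mul_mx_scalar !mul_scalar_mx.
rewrite !mexp_block !mulmx_block => /eq_block_mx[_ + _ _].
by rewrite !mulmx0 !mul0mx !mulmx1 !addr0 !add0r mul_scalar_mx.
Qed.

Lemma dexp_conj n (P P' Q Q' A B Z : 'M[R]_n) :
  P *m P' = 1%:M -> Q *m Q' = 1%:M ->
  dexp (P *m A *m P') (Q *m B *m Q') Z = P *m dexp A B (P' *m Z *m Q) *m Q'.
Proof.
move=> PP QQ; have P'P := mulmx1C PP; have Q'Q := mulmx1C QQ.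
have : mexp (block_mx (P *m A *m P') Z 0 (Q *m B *m Q')) *m block_mx P 0 0 Q =
    block_mx P 0 0 Q *m mexp (block_mx A (P' *m Z *m Q) 0 B).
  apply: mexp_intertwine; rewrite !mulmx_block !mulmx0 !mul0mx !addr0 !add0r.
  by rewrite -!mulmxA P'P Q'Q !mulmx1 [P *m (P' *m _)]mulmxA PP mul1mx.
rewrite !mexp_block !mulmx_block => /eq_block_mx[_ + _ _].
rewrite !mulmx0 !mul0mx !addr0 !add0r => <-.
by rewrite -[RHS]mulmxA QQ mulmx1.
Qed.

(** A matrix commutes with its exponential; the upper right block of this
    identity determines the divided difference when A and B have no common
    eigenvalue. *)
Lemma dexp_comm n (A B Z : 'M[R]_n) :
  A *m dexp A B Z + Z *m mexp B = mexp A *m Z + dexp A B Z *m B.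
Proof.
have : mexp (block_mx A Z 0 B) *m block_mx A Z 0 B =
  block_mx A Z 0 B *m mexp (block_mx A Z 0 B) by exact: mexp_intertwine.
by rewrite !mexp_block !mulmx_block => /eq_block_mx[_ <- _ _].
Qed.

Lemma cvg_block_mx (T : Type) (F : set_system T) (FF : Filter F) m n
    (a : T -> 'M[R]_m) (b : T -> 'M[R]_(m, n)) (c : T -> 'M[R]_(n, m))
    (d : T -> 'M[R]_n) (la : 'M[R]_m) (lb : 'M[R]_(m, n)) (lc : 'M[R]_(n, m))
    (ld : 'M[R]_n) :
  a @ F --> la -> b @ F --> lb -> c @ F --> lc -> d @ F --> ld ->
  block_mx (a t) (b t) (c t) (d t) @[t --> F] --> block_mx la lb lc ld.
Proof.
have coord p q (f : T -> 'M[R]_(p, q)) (l : 'M[R]_(p, q)) i j :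
    f @ F --> l -> f t i j @[t --> F] --> l i j.
  move=> fl; exact: (cvg_comp _ _ fl (@coord_continuous R p q i j l)).
move=> al bl cl dl; apply: cvg_mx => i j.
case: (split_ordP i) => i' ->; case: (split_ordP j) => j' ->.
- under eq_cvg do rewrite block_mxEul; rewrite block_mxEul; exact: coord.
- under eq_cvg do rewrite block_mxEur; rewrite block_mxEur; exact: coord.
- under eq_cvg do rewrite block_mxEdl; rewrite block_mxEdl; exact: coord.
- under eq_cvg do rewrite block_mxEdr; rewrite block_mxEdr; exact: coord.
Qed.

Lemma cvg_ursubmx (T : Type) (F : set_system T) (FF : Filter F) m n
    (a : T -> 'M[R]_(m + n)) (l : 'M[R]_(m + n)) :
  a @ F --> l -> ursubmx (a t) @[t --> F] --> ursubmx l.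
Proof.
move=> al; apply: cvg_mx => i j; rewrite !mxE.
under eq_cvg do rewrite !mxE.
exact: (cvg_comp _ _ al (@coord_continuous R _ _ _ _ l)).
Qed.

Lemma cvg_dexp (T : Type) (F : set_system T) (FF : Filter F) n
    (a b z : T -> 'M[R]_n) (la lb lz : 'M[R]_n) :
  a @ F --> la -> b @ F --> lb -> z @ F --> lz ->
  dexp (a t) (b t) (z t) @[t --> F] --> dexp la lb lz.
Proof.
move=> al bl zl; apply: cvg_ursubmx.
have H : block_mx (a t) (z t) 0 (b t) @[t --> F] --> block_mx la lz 0 lb.
  by apply: cvg_block_mx => //; exact: cvg_cst.
exact: (cvg_comp _ _ H (@continuous_mexp R _ _)).
Qed.

(** The difference quotient of exp along G is [dexp] at (G (h v + x), G x)
    applied to the difference quotient of G, and [dexp] is continuous. *)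
Lemma is_derive_mexp (V : normedModType R) n (G : V -> 'M[R]_n) x v D :
  is_derive x v G D ->
  is_derive x v (fun y => mexp (G y)) (dexp (G x) (G x) D).
Proof.
case=> dG GD.
have qD : h^-1 *: (G (h *: v + x) - G x) @[h --> (0 : R)^'] --> D.
  by rewrite -GD.
have Gc : G (h *: v + x) @[h --> (0 : R)^'] --> G x.
  suff : h *: (h^-1 *: (G (h *: v + x) - G x)) + G x @[h --> (0 : R)^'] -->
      0 *: D + G x.
    rewrite scale0r add0r; apply: cvg_trans; apply: near_eq_cvg.
    near=> h; rewrite scalerA divff ?scale1r ?subrK//.
    by near: h; exact: nbhs_dnbhs_neq.
  apply: cvgD; last exact: cvg_cst.
  apply: cvgZ => //; exact: cvg_within.
have L : h^-1 *: (mexp (G (h *: v + x)) - mexp (G x)) @[h --> (0 : R)^'] -->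
    dexp (G x) (G x) D.
  under eq_cvg do rewrite mexpB -dexpZ.
  by apply: cvg_dexp => //; exact: cvg_cst.
by split; [exact: cvgP L | exact: cvg_lim L].
Unshelve. all: by end_near. Qed.

(** The derivative is a block of an exponential of twice the size, hence the
    induction on k with the size generalized. *)
Lemma class_C_mexp (V : normedModType R) (E U : set V) k n
    (G : V -> 'M[R]_n) : dir_open E U ->
  class_C E U k G -> class_C E U k (fun x => mexp (G x)).
Proof.
move=> UE.
have C0 n' (G' : V -> 'M[R]_n') : {within U, continuous G'} ->
    {within U, continuous (fun x => mexp (G' x))}.
  by move=> Gc x; exact: (continuous_comp (Gc x) (@continuous_mexp _ _ _)).
elim: k n G => [|k IH] n G HG; first by split=> //; apply: C0; case: HG.
apply: class_CS => // [|v Ev]; first by apply: C0; case: HG.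
exists (fun x => dexp (G x) (G x) ('D_v G x)).
  have : class_C E U k (fun x => mexp (block_mx (G x) ('D_v G x) 0 (G x))).
    apply: IH; apply: class_C_block => //.
    - exact: class_CW.
    - exact: class_C_derive HG Ev.
    - exact: class_C_cst.
    - exact: class_CW.
  move=> /(class_C_mx UE) H; apply/(class_C_mx UE) => i j.
  by apply: (class_C_ext UE) (H (lshift n i) (rshift n j)) => x _; rewrite !mxE.
move=> x Ux; apply: is_derive_mexp; apply: derivableP.
exact: class_C_derivable HG Ux Ev.
Qed.

Lemma class_C_dexp (V : normedModType R) (E U : set V) k n
    (A B Z : V -> 'M[R]_n) : dir_open E U -> class_C E U k A ->
  class_C E U k B -> class_C E U k Z ->
  class_C E U k (fun x => dexp (A x) (B x) (Z x)).
Proof.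
move=> UE HA HB HZ.
have : class_C E U k (fun x => mexp (block_mx (A x) (Z x) 0 (B x))).
  by apply: class_C_mexp => //; apply: class_C_block => //; exact: class_C_cst.
move=> /(class_C_mx UE) H; apply/(class_C_mx UE) => i j.
by apply: (class_C_ext UE) (H (lshift n i) (rshift n j)) => x _; rewrite !mxE.
Qed.

(** The scalar divided difference of exp. *)
Definition expdd (a b : R) : R :=
  if a == b then expR a else (expR a - expR b) / (a - b).

Lemma expddxx a : expdd a a = expR a.
Proof. by rewrite /expdd eqxx. Qed.

Lemma expddE a b : (a - b) * expdd a b = expR a - expR b.
Proof.
rewrite /expdd; have [->|ab] := eqVneq a b; first by rewrite !subrr mul0r.
by rewrite mulrC divfK// subr_eq0.
Qed.

Lemma expddC a b : expdd a b = expdd b a.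
Proof.
rewrite /expdd eq_sym; case: eqVneq => [->//|ab].
by rewrite -[expR a - _]opprB -[a - b]opprB invrN mulrNN.
Qed.

Lemma expdd_gt0 a b : 0 < expdd a b.
Proof.
wlog ab : a b / a <= b.
  by move=> W; have [/W//|/ltW/W] := leP a b; rewrite expddC.
rewrite /expdd; case: eqVneq => [_|nab]; first exact: expR_gt0.
have ab' : a < b by rewrite lt_neqAle nab.
by rewrite -mulrNN -invrN !opprB divr_gt0// subr_gt0// ltr_expR.
Qed.

Lemma cvg_expdd a b : expdd (h + a) b @[h --> (0 : R)^'] --> expdd a b.
Proof.
have [->|ab] := eqVneq a b.
  rewrite expddxx.
  have [dE <-] := is_derive_expR b; move: dE; rewrite /derivable => dE.
  apply: cvg_trans dE; apply: near_eq_cvg; near=> h.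
  have h0 : h != 0 by near: h; exact: nbhs_dnbhs_neq.
  rewrite /expdd /= scaler1 -subr_eq0 addrK (negbTE h0).
  by rewrite /GRing.scale /= mulrC.
have H : h + a @[h --> (0 : R)^'] --> a.
  rewrite -[X in _ --> X]add0r; apply: cvgD; last exact: cvg_cst.
  exact: cvg_within.
have H0 : \forall h \near (0 : R)^', h + a - b != 0.
  apply: (@cvgr_neq0 _ _ _ _ _ _ (a - b)); last by rewrite subr_eq0.
  by apply: cvgB => //; exact: cvg_cst.
rewrite {2}/expdd (negbTE ab).
suff : (expR (h + a) - expR b) / (h + a - b) @[h --> (0 : R)^'] -->
    (expR a - expR b) / (a - b).
  apply: cvg_trans; apply: near_eq_cvg; near=> h.
  by rewrite /expdd ifN// -subr_eq0; near: h.
apply: cvgM.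
  apply: cvgB; last exact: cvg_cst.
  exact: cvg_comp H (@continuous_expR R a).
apply: cvgV; first by rewrite subr_eq0.
by apply: cvgB => //; exact: cvg_cst.
Unshelve. all: by end_near. Qed.

(** [dexp_comm] gives the entry (i, j) after division by a_i - b_j; equal
    eigenvalues are reached by shifting a by a scalar h tending to 0. *)
Lemma dexp_diag n (a b : 'rV[R]_n) Z :
  dexp (diag_mx a) (diag_mx b) Z =
  \matrix_(i, j) (expdd (a 0 i) (b 0 j) * Z i j).
Proof.
apply/matrixP => i j; rewrite [RHS]mxE.
set F := fun h : R => dexp (diag_mx (const_mx h + a)) (diag_mx b) Z i j.
have FE h : h + a 0 i != b 0 j -> F h = expdd (h + a 0 i) (b 0 j) * Z i j.
  move=> hab; have := dexp_comm (diag_mx (const_mx h + a)) (diag_mx b) Z.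
  rewrite /F; move: (dexp _ _ _) => Y /matrixP/(_ i j).
  rewrite !mexp_diag !mul_diag_mx !mul_mx_diag !mxE => H.
  apply: (@mulfI _ (h + a 0 i - b 0 j)); first by rewrite subr_eq0.
  by rewrite mulrA expddE; lra.
have F0 : F h @[h --> (0 : R)^'] --> dexp (diag_mx a) (diag_mx b) Z i j.
  have : dexp (diag_mx (const_mx h + a)) (diag_mx b) Z @[h --> (0 : R)^'] -->
      dexp (diag_mx a) (diag_mx b) Z.
    apply: cvg_dexp; [|exact: cvg_cst|exact: cvg_cst].
    apply: cvg_mx => p q.
    under eq_cvg do rewrite !mxE; rewrite !mxE.
    have H : h + a 0 p @[h --> (0 : R)^'] --> a 0 p.
      rewrite -[X in _ --> X]add0r; apply: cvgD; last exact: cvg_cst.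
      exact: cvg_within.
    case: (p == q); first exact: H.
    exact: cvg_cst.
  by move=> H; exact: (cvg_comp _ _ H (@coord_continuous R _ _ _ _ _)).
have F1 : F h @[h --> (0 : R)^'] --> expdd (a 0 i) (b 0 j) * Z i j.
  have Hn : \forall h \near (0 : R)^', h + a 0 i != b 0 j.
    have [->|ab] := eqVneq (a 0 i) (b 0 j).
      near=> h; rewrite -subr_eq0 addrK; near: h; exact: nbhs_dnbhs_neq.
    near=> h; rewrite -subr_eq0 -addrA; near: h.
    apply: (@cvgr_neq0 _ _ _ _ _ _ (a 0 i - b 0 j)); last by rewrite subr_eq0.
    rewrite -[X in _ --> X]add0r; apply: cvgD; last exact: cvg_cst.
    exact: cvg_within.
  have : expdd (h + a 0 i) (b 0 j) * Z i j @[h --> (0 : R)^'] -->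
      expdd (a 0 i) (b 0 j) * Z i j.
    by apply: cvgM; [exact: cvg_expdd | exact: cvg_cst].
  apply: cvg_trans; apply: near_eq_cvg; near=> h; rewrite FE//.
  by near: h.
exact: (cvg_unique _ F0 F1).
Unshelve. all: by end_near. Qed.

End DividedExp.

(** * The spectral theorem for real symmetric matrices *)

Section Spectral.
Context (R : realType).

(** The complexified matrix is Hermitian, so it has an eigenvalue, and all its
    eigenvalues are real; a real root of the characteristic polynomial is an
    eigenvalue over R. *)
Lemma sym_eigenvalue n (A : 'M[R]_n.+1) : A^T = A ->
  exists (a : R) (v : 'rV[R]_n.+1), v *m A = a *: v /\ v != 0.
Proof.
move=> symA.
pose B : 'M[complex R]_n.+1 := map_mx (fun x : R => real_complex R x) A.
have Breal : B \is a mxOver (@Num.real (complex R)).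
  by apply/mxOverP => i j; rewrite mxE; apply/complex_realP; exists (A i j).
have Bsym : B \is symmetricmx.
  apply/is_hermitianmxP; rewrite expr0 scale1r.
  by apply/matrixP => i j; rewrite !mxE -[in LHS]symA mxE.
have Bherm := realsym_hermsym Bsym Breal.
have dreal := hermitian_spectral_diag_real Bherm.
have := orthomx_spectralP (hermitian_normalmx Bherm).
set P := spectralmx B; set d := spectral_diag B => BE.
have Punit : P \in unitmx by exact: spectral_unit.
have PB : P *m B = diag_mx d *m P.
  by rewrite {1}BE !mulmxA mulmxV// mul1mx.
have [k dk] : exists k, d 0 0 = real_complex R k.
  by apply/complex_realP; move/mxOverP: dreal; exact.
have EB : eigenvalue B (real_complex R k).
  apply/eigenvalueP; exists (row 0 P).
    by rewrite -row_mul PB mul_diag_mx -dk; apply/rowP => j; rewrite !mxE.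
  apply/eqP => P0; move: Punit; rewrite -row_free_unit => /row_freeP[Q PQ].
  have /rowP/(_ 0) : row 0 (P *m Q) = 0 by rewrite row_mul P0 mul0mx.
  by rewrite PQ !mxE => /eqP; rewrite oner_eq0.
have : eigenvalue A k.
  move: EB; rewrite !eigenvalue_root_char.
  by rewrite -[char_poly B]map_char_poly fmorph_root.
by move=> /eigenvalueP[v vA v0]; exists k, v.
Qed.

(** The reflection in the hyperplane orthogonal to v - e_0 exchanges these two
    unit vectors. *)
Lemma householder n (v : 'cV[R]_n.+1) : v^T *m v = 1%:M ->
  exists Q : 'M[R]_n.+1, [/\ Q^T = Q, Q *m Q = 1%:M & Q *m delta_mx 0 0 = v].
Proof.
move=> vv; set e : 'cV[R]_n.+1 := delta_mx 0 0.
have ee : e^T *m e = 1%:M.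
  by apply/matrixP => i j; rewrite trmx_delta mul_delta_mx !mxE !ord1 eqxx.
have [->|ve] := eqVneq v e.
  by exists 1%:M; split; rewrite ?trmx1 ?mulmx1 ?mul1mx.
set w := v - e; pose b := (v^T *m e) 0 0.
have bE : v^T *m e = b%:M by rewrite [LHS]mx11_scalar.
have bE' : e^T *m v = b%:M.
  by rewrite -[e^T *m v]trmxK trmx_mul trmxK bE tr_scalar_mx.
have wT : w^T = v^T - e^T by rewrite linearB.
have we : w^T *m e = (b - 1)%:M by rewrite wT mulmxBl bE ee -raddfB.
have ww : w^T *m w = (2 - 2 * b)%:M.
  rewrite {2}/w mulmxBr we wT mulmxBl vv bE' -!raddfB; congr (_%:M); ring.
have s0 : 2 - 2 * b != 0.
  apply/eqP => s0; move: ww; rewrite s0 => /matrixP/(_ 0 0).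
  rewrite !mxE mul0rn => /eqP; rewrite psumr_eq0 => [|i _]; last first.
    by rewrite mxE -expr2 sqr_ge0.
  move=> /allP w0; case/eqP: ve; apply/eqP; rewrite -subr_eq0; apply/eqP.
  apply/matrixP => i j; rewrite ord1 [RHS]mxE; apply/eqP.
  have := w0 i (mem_index_enum i); rewrite mxE /= mulf_eq0.
  by case/orP.
pose c := 2 / (2 - 2 * b).
have cs : c * (2 - 2 * b) = 2 by rewrite divfK.
exists (1%:M - c *: (w *m w^T)); split.
- by rewrite linearB /= linearZ /= trmx_mul trmxK trmx1.
- rewrite mulmxBl mul1mx mulmxBr mulmx1 -scalemxAl -scalemxAr.
  rewrite -mulmxA [w^T *m _]mulmxA ww mul_scalar_mx -scalemxAr !scalerA.
  move: (w *m w^T) => W; apply/matrixP => i j; rewrite !mxE.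
  by rewrite cs; ring.
- rewrite mulmxBl mul1mx -scalemxAl -mulmxA we mul_mx_scalar scalerA.
  have -> : c * (b - 1) = - 1.
    have two : (2 : R) != 0 by rewrite pnatr_eq0.
    by apply: (mulfI two); have := cs; lra.
  by rewrite scaleN1r opprK /w addrC subrK.
Qed.

(** A reflection moves a unit eigenvector to the first basis vector; by symmetry
    the conjugated matrix is then block diagonal, which allows induction on the
    size. *)
Lemma sym_diagonalizable n (A : 'M[R]_n) : A^T = A ->
  exists (P : 'M[R]_n) (d : 'rV[R]_n),
    Orth P /\ A = P *m diag_mx d *m P^T.
Proof.
elim: n A => [|n IH] A symA.
  exists 1%:M, 0; split; first by rewrite /Orth /= mulmx1 trmx1.
  by apply/matrixP => -[].
have [a [v0 [v0A v0n]]] := sym_eigenvalue symA.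
pose s := (v0 *m v0^T) 0 0.
have sE : v0 *m v0^T = s%:M by rewrite [LHS]mx11_scalar.
have s0 : 0 < s.
  rewrite lt_neqAle eq_sym; apply/andP; split; last first.
    by rewrite /s mxE; apply: sumr_ge0 => i _; rewrite mxE -expr2 sqr_ge0.
  rewrite /s mxE psumr_eq0 => [|i _]; last by rewrite mxE -expr2 sqr_ge0.
  apply: contra v0n => /allP w0; apply/eqP/matrixP => i j.
  rewrite ord1 [RHS]mxE; apply/eqP.
  by have := w0 j (mem_index_enum j); rewrite mxE /= mulf_eq0 => /orP[].
pose v := (Num.sqrt s)^-1 *: v0^T.
have vv : v^T *m v = 1%:M.
  rewrite /v [(_ *: _)^T]linearZ /= trmxK -scalemxAl -scalemxAr sE.
  rewrite scalerA -invfM -expr2.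
  rewrite sqr_sqrtr ?ltW// -mul_scalar_mx -scalar_mxM mulVf//.
  by rewrite gt_eqF.
have Av : A *m v = a *: v.
  have -> : A *m v = (v^T *m A)^T by rewrite trmx_mul trmxK symA.
  rewrite /v [(_ *: _)^T]linearZ /= trmxK -scalemxAl v0A !linearZ /=.
  by rewrite scalerA mulrC -scalerA.
have [Q [QT QQ Qe]] := householder vv.
have [B BQ] : exists B : 'M[R]_(1 + n), B = Q *m A *m Q by exists (Q *m A *m Q).
have BT : B^T = B by rewrite BQ !trmx_mul QT symA mulmxA.
have Be : Q *m A *m Q *m delta_mx 0 0 = a *: (delta_mx 0 0 : 'cV[R]_n.+1).
  by rewrite -mulmxA Qe -mulmxA Av -scalemxAr -Qe mulmxA QQ mul1mx.
have B0 i : B i 0 = a * (i == 0)%:R.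
  have /matrixP/(_ i 0) := Be; rewrite -BQ.
  by rewrite -colE !mxE eqxx andbT.
have symB' : (drsubmx B)^T = drsubmx B by rewrite trmx_drsub BT.
have [P' [d' [OP' B'E]]] := IH _ symB'.
have BE : B = block_mx (a%:M) 0 0 (drsubmx B).
  rewrite -[LHS]submxK; congr block_mx.
  - apply/matrixP => i j; rewrite !ord1 !mxE.
    have -> : lshift n (0 : 'I_1) = 0 by exact/val_inj.
    by rewrite B0 eqxx mulr1 mulr1n.
  - rewrite -{1}BT -trmx_dlsub; apply/matrixP => i j.
    rewrite !mxE ord1.
    have -> : lshift n (0 : 'I_1) = 0 by exact/val_inj.
    by rewrite B0 mulr0.
  - apply/matrixP => i j; rewrite !mxE ord1.
    have -> : lshift n (0 : 'I_1) = 0 by exact/val_inj.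
    by rewrite B0 mulr0.
pose P1 : 'M[R]_(1 + n) := block_mx 1%:M 0 0 P'.
pose D := diag_mx (row_mx a%:M d' : 'rV[R]_(1 + n)).
have OP1 : P1^T *m P1 = 1%:M.
  rewrite /P1 tr_block_mx mulmx_block !trmx1 !trmx0 !mulmx0 !mul0mx !mulmx1.
  by rewrite !addr0 !add0r OP' -scalar_mx_block.
have P1B : B = P1 *m D *m P1^T.
  have -> : D = block_mx a%:M 0 0 (diag_mx d').
    rewrite /D diag_mx_row; congr block_mx.
    by apply/matrixP => i j; rewrite !mxE !ord1 eqxx mulr1n.
  rewrite BE B'E /P1 tr_block_mx !mulmx_block !trmx1 !trmx0 !mulmx0 !mul0mx.
  by rewrite !mulmx1 !mul1mx !addr0 !add0r mul0mx.
suff : exists (P : 'M[R]_(1 + n)) (d : 'rV[R]_(1 + n)),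
    Orth P /\ (A : 'M[R]_(1 + n)) = P *m diag_mx d *m P^T by [].
pose Q' : 'M[R]_(1 + n) := Q.
have Q'Q : Q' *m Q' = 1%:M by exact: QQ.
have Q'T : Q'^T = Q' by exact: QT.
exists (Q' *m P1), (row_mx a%:M d' : 'rV[R]_(1 + n)); split.
  rewrite /Orth /= trmx_mul Q'T -mulmxA [Q' *m (Q' *m P1)]mulmxA Q'Q.
  by rewrite mul1mx OP1.
rewrite trmx_mul Q'T -/D.
have -> : Q' *m P1 *m D *m (P1^T *m Q') = Q' *m B *m Q' by rewrite P1B !mulmxA.
have -> : B = Q' *m A *m Q' by exact: BQ.
by rewrite !mulmxA Q'Q mul1mx -mulmxA Q'Q mulmx1.
Qed.

End Spectral.

(** * Spectral functions on positive definite matrices *)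

Section SpectralFun.
Context (R : realType).

Lemma orthT n (P : 'M[R]_n) : Orth P -> P *m P^T = 1%:M.
Proof. exact: mulmx1C. Qed.

Lemma orth1 n : Orth (1%:M : 'M[R]_n).
Proof. by rewrite /Orth /= trmx1 mulmx1. Qed.

Lemma orthM n (P Q : 'M[R]_n) : Orth P -> Orth Q -> Orth (P *m Q).
Proof.
by rewrite /Orth /= => OP OQ; rewrite trmx_mul -mulmxA [P^T *m _]mulmxA OP mul1mx.
Qed.

(** The squared Frobenius norm, invariant under orthogonal matrices on either
    side. *)
Definition frob2 m n (A : 'M[R]_(m, n)) : R := \sum_i \sum_j A i j ^+ 2.

Lemma frob2_tr m n (A : 'M[R]_(m, n)) : frob2 A = \tr (A *m A^T).
Proof.
apply: eq_bigr => i _; rewrite mxE; apply: eq_bigr => j _.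
by rewrite mxE expr2.
Qed.

Lemma frob2_ge0 m n (A : 'M[R]_(m, n)) : 0 <= frob2 A.
Proof. by apply: sumr_ge0 => i _; apply: sumr_ge0 => j _; rewrite sqr_ge0. Qed.

Lemma frob2Z m n c (A : 'M[R]_(m, n)) : frob2 (c *: A) = c ^+ 2 * frob2 A.
Proof.
rewrite /frob2 mulr_sumr; apply: eq_bigr => i _.
by rewrite mulr_sumr; apply: eq_bigr => j _; rewrite mxE exprMn.
Qed.

Lemma frob2_orth n (P Q A : 'M[R]_n) : Orth P -> Orth Q ->
  frob2 (P^T *m A *m Q) = frob2 A.
Proof.
move=> /orthT OP /orthT OQ; rewrite !frob2_tr !trmx_mul trmxK.
rewrite -mulmxA [Q *m _]mulmxA OQ mul1mx !mulmxA -!mulmxA.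
by rewrite mxtrace_mulC -!mulmxA [A^T *m _]mulmxA -?mulmxA OP mulmx1.
Qed.

Lemma entry_le_frob2 m n (A : 'M[R]_(m, n)) i j : A i j ^+ 2 <= frob2 A.
Proof.
rewrite /frob2 (bigD1 i)//= (bigD1 j)//= -addrA lerDl addr_ge0//.
  by apply: sumr_ge0 => l _; rewrite sqr_ge0.
by apply: sumr_ge0 => k _; apply: sumr_ge0 => l _; rewrite sqr_ge0.
Qed.

(** The difference of two symmetric matrices, seen from the eigenbases P and Q of
    both, has entries (a_i - b_j) W_ij with W = P^T Q.  Applying a function f to
    both matrices only replaces a_i - b_j by f a_i - f b_j, which reduces
    comparisons of matrices to comparisons of numbers. *)
Lemma spectral_subE n (P Q : 'M[R]_n) (a b : 'rV[R]_n) : Orth P -> Orth Q ->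
  P^T *m (P *m diag_mx a *m P^T - Q *m diag_mx b *m Q^T) *m Q =
  \matrix_(i, j) ((a 0 i - b 0 j) * (P^T *m Q) i j).
Proof.
rewrite /Orth /= => OP OQ; rewrite mulmxBr mulmxBl.
rewrite -!mulmxA OQ mulmx1 !mulmxA OP mul1mx -mulmxA mul_diag_mx mul_mx_diag.
by move: (P^T *m Q) => W; apply/matrixP => i j; rewrite !mxE; ring.
Qed.

Lemma frob2_spectral_sub n (P Q : 'M[R]_n) (a b : 'rV[R]_n) :
  Orth P -> Orth Q ->
  frob2 (P *m diag_mx a *m P^T - Q *m diag_mx b *m Q^T) =
  \sum_i \sum_j (a 0 i - b 0 j) ^+ 2 * (P^T *m Q) i j ^+ 2.
Proof.
move=> OP OQ; rewrite -(frob2_orth _ OP OQ) spectral_subE//.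
by apply: eq_bigr => i _; apply: eq_bigr => j _; rewrite mxE exprMn.
Qed.

Lemma spectral_lipschitz n (P Q : 'M[R]_n) (a b : 'rV[R]_n) f C :
  Orth P -> Orth Q ->
  (forall i j, (f (a 0 i) - f (b 0 j)) ^+ 2 <= C * (a 0 i - b 0 j) ^+ 2) ->
  frob2 (P *m diag_mx (map_mx f a) *m P^T - Q *m diag_mx (map_mx f b) *m Q^T) <=
  C * frob2 (P *m diag_mx a *m P^T - Q *m diag_mx b *m Q^T).
Proof.
move=> OP OQ H; rewrite !frob2_spectral_sub// mulr_sumr; apply: ler_sum => i _.
rewrite mulr_sumr; apply: ler_sum => j _.
by rewrite !mxE mulrA ler_wpM2r ?sqr_ge0.
Qed.

(** The column j of W = P^T Q is a unit vector, so the weights W_ij^2 average the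
    numbers (a_i - b_j)^2 to at most the squared Frobenius norm. *)
Lemma eigenvalue_close n (P Q : 'M[R]_n) (a b : 'rV[R]_n) j :
  Orth P -> Orth Q -> exists i, (a 0 i - b 0 j) ^+ 2 <=
    frob2 (P *m diag_mx a *m P^T - Q *m diag_mx b *m Q^T).
Proof.
move=> OP OQ; set F := frob2 _; apply: contrapT => /forallNP nex.
have gtF i : F < (a 0 i - b 0 j) ^+ 2 by rewrite ltNge; exact/negP/nex.
pose W := P^T *m Q.
have W1 : \sum_i W i j ^+ 2 = 1.
  have : W^T *m W = 1%:M.
    by rewrite trmx_mul trmxK -mulmxA [P *m _]mulmxA (orthT OP) mul1mx.
  move/matrixP/(_ j j); rewrite [LHS]mxE [RHS]mxE eqxx => W1.
  rewrite -[RHS]W1.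
  by apply: eq_bigr => i _; rewrite [W^T _ _]mxE expr2.
have : \sum_i ((a 0 i - b 0 j) ^+ 2 - F) * W i j ^+ 2 <= 0.
  under eq_bigr do rewrite mulrBl.
  rewrite big_split /= sumrN -mulr_sumr W1 mulr1 subr_le0.
  rewrite /F frob2_spectral_sub//; apply: ler_sum => i _.
  rewrite (bigD1 j)//= lerDl; apply: sumr_ge0 => l _.
  by rewrite mulr_ge0 ?sqr_ge0.
have ge0 i : 0 <= ((a 0 i - b 0 j) ^+ 2 - F) * W i j ^+ 2.
  by rewrite mulr_ge0 ?sqr_ge0// subr_ge0 ltW.
move=> sum_le0; have /eqP : \sum_i ((a 0 i - b 0 j) ^+ 2 - F) * W i j ^+ 2 = 0.
  by apply: le_anti; rewrite sum_le0 sumr_ge0.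
rewrite psumr_eq0// => /allP W0.
have W00 i : W i j ^+ 2 = 0.
  have := W0 i (mem_index_enum i); rewrite /= mulf_eq0 subr_eq0.
  by rewrite gt_eqF//= => /eqP.
by move: W1; rewrite big1// => /eqP; rewrite eq_sym oner_eq0.
Qed.

(** Two diagonalizations of the same matrix satisfy (d_i - e_j) W_ij = 0, hence
    (f d_i - f e_j) W_ij = 0, so they define the same matrix. *)
Lemma spectral_funE n (f : R -> R) (P : 'M[R]_n) (d : 'rV[R]_n) : Orth P ->
  spectral_fun f (P *m diag_mx d *m P^T) = P *m diag_mx (map_mx f d) *m P^T.
Proof.
move=> OP; rewrite /spectral_fun; set Yf := RHS.
case: xgetP => [Y _ |/(_ Yf) []]; last first.
  by exists P, d.
move=> [Q [e [OQ SE ->]]].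
have := frob2_spectral_sub d e OP OQ; rewrite SE subrr.
have -> : frob2 (0 : 'M[R]_n) = 0.
  by rewrite /frob2 big1// => i _; rewrite big1// => j _; rewrite mxE expr0n.
move=> /esym/eqP; rewrite psumr_eq0 => [/allP H|i _]; last first.
  by apply: sumr_ge0 => j _; rewrite mulr_ge0 ?sqr_ge0.
have feq i j : (f (d 0 i) - f (e 0 j)) * (P^T *m Q) i j = 0.
  have := H i (mem_index_enum i).
  rewrite /= psumr_eq0 => [/allP H'|l _]; last first.
    by rewrite mulr_ge0 ?sqr_ge0.
  have := H' j (mem_index_enum j); rewrite /= -exprMn expf_eq0 /= mulf_eq0.
  by rewrite subr_eq0 => /orP[/eqP->|/eqP->]; rewrite ?subrr ?mul0r ?mulr0.
have := spectral_subE (map_mx f d) (map_mx f e) OP OQ.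
rewrite (_ : \matrix_(i, j) _ = 0); last first.
  by apply/matrixP => i j; rewrite mxE [RHS]mxE -[RHS](feq i j) !mxE.
move=> H0; apply/eqP; rewrite eq_sym -subr_eq0; apply/eqP.
move/(congr1 (fun M => P *m M *m Q^T)) : H0.
rewrite mulmx0 mul0mx -!mulmxA (orthT OQ) mulmx1 !mulmxA (orthT OP) mul1mx.
by [].
Qed.

Lemma spd_diag_gt0 n (P : 'M[R]_n) (d : 'rV[R]_n) i : Orth P ->
  SPD (P *m diag_mx d *m P^T) -> 0 < d 0 i.
Proof.
rewrite /Orth /= => OP; pose e : 'cV[R]_n := delta_mx i 0.
move=> [_ /(_ (P *m e))].
have -> : (P *m e)^T *m (P *m diag_mx d *m P^T) *m (P *m e) = (d 0 i)%:M.
  rewrite trmx_mul -!mulmxA [P^T *m (P *m e)]mulmxA OP mul1mx.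
  rewrite [P^T *m (P *m _)]mulmxA OP mul1mx mul_diag_mx trmx_delta.
  by apply/matrixP => k l; rewrite -rowE !mxE !ord1 !eqxx mulr1 mulr1n.
rewrite mxE eqxx mulr1n; apply.
apply/eqP => /(congr1 (mulmx P^T)); rewrite mulmxA OP mul1mx mulmx0.
by move/matrixP/(_ i 0); rewrite !mxE !eqxx => /eqP; rewrite oner_eq0.
Qed.

Lemma diag_spd n (P : 'M[R]_n) (d : 'rV[R]_n) : Orth P ->
  (forall i, 0 < d 0 i) -> SPD (P *m diag_mx d *m P^T).
Proof.
move=> OP d0; split; first by rewrite !trmx_mul trmxK tr_diag_mx mulmxA.
move=> x x0; pose y := P^T *m x.
have -> : x^T *m (P *m diag_mx d *m P^T) *m x = y^T *m diag_mx d *m y.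
  by rewrite /y trmx_mul trmxK !mulmxA.
rewrite mul_mx_diag mxE.
have -> : \sum_j (\matrix_(i0, j0) (y^T i0 j0 * d 0 j0)) 0 j * y j 0 =
    \sum_j d 0 j * y j 0 ^+ 2.
  by apply: eq_bigr => j _; rewrite !mxE expr2; ring.
have ge0 j : 0 <= d 0 j * y j 0 ^+ 2 by rewrite mulr_ge0 ?sqr_ge0 ?ltW.
rewrite lt_neqAle sumr_ge0 ?andbT => [|j _]; last exact: ge0.
rewrite eq_sym psumr_eq0 => [|j _]; last exact: ge0.
apply: contra x0 => /allP H; have y0 : y = 0.
  apply/matrixP => i j; rewrite ord1 [RHS]mxE; apply/eqP.
  have := H i (mem_index_enum i); rewrite /= mulf_eq0 gt_eqF//=.
  by rewrite sqrf_eq0.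
by rewrite -[x]mul1mx -(orthT OP) -mulmxA -/y y0 mulmx0.
Qed.

Lemma spd_diagonalizable n (S : 'M[R]_n) : SPD S ->
  exists (P : 'M[R]_n) (d : 'rV[R]_n), [/\ Orth P, (forall i, 0 < d 0 i) &
    S = P *m diag_mx d *m P^T].
Proof.
move=> spdS; have [P [d [OP SE]]] := sym_diagonalizable spdS.1.
exists P, d; split=> // i; apply: (spd_diag_gt0 _ OP).
by rewrite -SE.
Qed.

Lemma row_pos_lb n (d : 'rV[R]_n) : (forall i, 0 < d 0 i) ->
  exists2 c, 0 < c & forall i, c <= d 0 i.
Proof.
move=> d0; exists (\big[Num.min/1]_i d 0 i).
  by apply: lt_bigmin.
by move=> i; exact: bigmin_le.
Qed.

(** The eigenvalues of h X + S stay close to those of S, which are bounded below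
    by a positive number. *)
Lemma spd_dir_open n : dir_open (@Sym R n) (@SPD R n).
Proof.
move=> S X spdS symX.
have [P [a [OP a0 SE]]] := spd_diagonalizable spdS.
have [c c0 ca] := row_pos_lb a0.
have K0 : 0 < frob2 X + 1 by rewrite ltr_wpDl ?frob2_ge0.
have H : \forall h \near (0 : R)^', `|h| < Num.min 1 (c ^+ 2 / (frob2 X + 1)).
  by apply: dnbhs0_lt; rewrite lt_min ltr01 divr_gt0 ?exprn_gt0.
apply: filterS H => h; rewrite lt_min => /andP[h1 hc].
have symT : (h *: X + S)^T = h *: X + S.
  by rewrite linearD linearZ /= spdS.1 symX.
have [Q [b [OQ TE]]] := sym_diagonalizable symT.
rewrite TE; apply: diag_spd => // j.
have [i Hi] := eigenvalue_close a b j OP OQ; move: Hi.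
rewrite -SE -TE opprD addrCA subrr addr0 -scaleNr frob2Z sqrrN => Hi.
have dist_lt : (a 0 i - b 0 j) ^+ 2 < c ^+ 2.
  apply: le_lt_trans Hi _.
  apply: (@le_lt_trans _ _ (`|h| * (frob2 X + 1))); last by rewrite -ltr_pdivlMr.
  have h2 : h ^+ 2 <= `|h|.
    by rewrite -real_normK ?num_real// expr2 ler_piMl// ltW.
  apply: (@le_trans _ _ (`|h| * frob2 X)); first by rewrite ler_wpM2r ?frob2_ge0.
  by rewrite ler_wpM2l// lerDl.
have := ca i; move: dist_lt.
rewrite -ltr_sqrt ?exprn_gt0// !sqrtr_sqr (gtr0_norm c0) ltr_norml.
by move=> /andP[_ H1] H2; lra.
Qed.

End SpectralFun.

(** * Smoothness of the logarithm and of the powers *)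

Section LogPow.
Context (R : realType) (n : nat).
Implicit Types (P Q S X Y Z : 'M[R]_n) (d a b : 'rV[R]_n).

Lemma mexp_spectral P d : Orth P ->
  mexp (P *m diag_mx d *m P^T) = P *m diag_mx (map_mx (@expR R) d) *m P^T.
Proof. by move=> OP; rewrite mexp_conj ?orthT// mexp_diag. Qed.

Lemma dexp_spectral P Q a b Z : Orth P -> Orth Q ->
  dexp (P *m diag_mx a *m P^T) (Q *m diag_mx b *m Q^T) Z =
  P *m (\matrix_(i, j) (expdd (a 0 i) (b 0 j) * (P^T *m Z *m Q) i j)) *m Q^T.
Proof.
move=> OP OQ.
by rewrite (dexp_conj _ _ _ (orthT OP) (orthT OQ)) dexp_diag.
Qed.

Lemma dexp_linear A B : A^T = A -> B^T = B -> linear (@dexp R n A B).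
Proof.
move=> /sym_diagonalizable[P [a [OP ->]]] /sym_diagonalizable[Q [b [OQ ->]]].
pose M (W : 'M[R]_n) : 'M[R]_n := \matrix_(i, j) (expdd (a 0 i) (b 0 j) * W i j).
have ML c Y Z : M (c *: Y + Z) = c *: M Y + M Z.
  by apply/matrixP => i j; rewrite !mxE; ring.
move=> c Y Z; rewrite !dexp_spectral// -!/(M _).
rewrite [P^T *m (_ + _)]mulmxDr mulmxDl -scalemxAr -scalemxAl ML.
by rewrite mulmxDr mulmxDl -scalemxAr -scalemxAl.
Qed.

(** The divided differences of exp are positive, so in eigenbases of A and B the
    map multiplies each entry by a positive number. *)
Lemma dexp_inj A B Z : A^T = A -> B^T = B -> dexp A B Z = 0 -> Z = 0.
Proof.
move=> /sym_diagonalizable[P [a [OP ->]]] /sym_diagonalizable[Q [b [OQ ->]]].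
rewrite !dexp_spectral// => /(congr1 (fun M => P^T *m M *m Q)).
rewrite mulmx0 mul0mx !mulmxA OP mul1mx -mulmxA OQ mulmx1 => H.
have Z0 : P^T *m Z *m Q = 0.
  apply/matrixP => i j; move/matrixP/(_ i j): H.
  rewrite [LHS]mxE [RHS]mxE => /eqP.
  by rewrite mulf_eq0 gt_eqF ?expdd_gt0//= => /eqP ->; rewrite mxE.
move/(congr1 (fun M => P *m M *m Q^T)): Z0.
by rewrite mulmx0 mul0mx !mulmxA (orthT OP) mul1mx -mulmxA (orthT OQ) mulmx1.
Qed.

Lemma mxlogE P d : Orth P ->
  mxlog (P *m diag_mx d *m P^T) = P *m diag_mx (map_mx (@ln R) d) *m P^T.
Proof. exact: spectral_funE. Qed.

Lemma mxpowE p P d : Orth P -> mxpow p (P *m diag_mx d *m P^T) =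
  P *m diag_mx (map_mx (fun x => x `^ p) d) *m P^T.
Proof. exact: spectral_funE. Qed.

Lemma mxlog_sym S : SPD S -> (mxlog S)^T = mxlog S.
Proof.
move=> /spd_diagonalizable[P [d [OP _ ->]]].
by rewrite mxlogE// !trmx_mul trmxK tr_diag_mx mulmxA.
Qed.

Lemma mexp_mxlog S : SPD S -> mexp (mxlog S) = S.
Proof.
move=> /spd_diagonalizable[P [d [OP d0 ->]]].
rewrite mxlogE// mexp_spectral//; congr (_ *m diag_mx _ *m _).
by apply/rowP => i; rewrite !mxE lnK// posrE.
Qed.

Lemma mxpow_mexp p S : SPD S -> mxpow p S = mexp (p *: mxlog S).
Proof.
move=> /spd_diagonalizable[P [d [OP d0 ->]]].
rewrite mxlogE// mxpowE//.
have -> : p *: (P *m diag_mx (map_mx (@ln R) d) *m P^T) =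
    P *m diag_mx (p *: map_mx (@ln R) d) *m P^T.
  by rewrite linearZ /= -scalemxAr -scalemxAl.
rewrite mexp_spectral//; congr (_ *m diag_mx _ *m _).
by apply/rowP => i; rewrite !mxE /powR gt_eqF.
Qed.

Lemma ln_lipschitz (c x y : R) : 0 < c -> c <= x -> c <= y ->
  (ln x - ln y) ^+ 2 <= c ^- 2 * (x - y) ^+ 2.
Proof.
move=> c0; wlog xy : x y / y <= x.
  move=> W cx cy; have [yx|/ltW yx] := leP y x; first exact: W.
  by rewrite -opprB sqrrN -[x - y]opprB sqrrN; exact: W.
move=> cx cy; have y0 : 0 < y by exact: lt_le_trans cy.
have x0 : 0 < x by exact: lt_le_trans cx.
rewrite -exprVn -exprMn.
have l0 : 0 <= ln x - ln y by rewrite subr_ge0 ler_ln ?posrE.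
have lnle : ln x - ln y <= c^-1 * (x - y).
  rewrite -ln_div ?posrE//; apply: (@le_trans _ _ (x / y - 1)).
    rewrite -[x / y](subrK 1) addrC addrAC subrr add0r.
    by apply: le_ln1Dx; rewrite ltrBrDr addNr divr_gt0.
  have -> : x / y - 1 = y^-1 * (x - y) by field; rewrite gt_eqF.
  by rewrite ler_wpM2r ?subr_ge0// lef_pV2.
by rewrite lerXn2r ?nnegrE// (le_trans l0).
Qed.

Lemma frob2_lt_norm m1 m2 (M : 'M[R]_(m1, m2)) e : 0 < e ->
  frob2 M < e ^+ 2 -> `|M| < e.
Proof.
move=> e0 Me; rewrite /Num.Def.normr/= mx_normrE (bigmax_lt _ e0)//= => -[i j] _.
rewrite -sqrtr_sqr -[e]gtr0_norm// -[`|e|]sqrtr_sqr ltr_sqrt ?exprn_gt0//.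
exact: le_lt_trans (entry_le_frob2 _ _ _) Me.
Qed.

Lemma frob2_le_norm m1 m2 (M : 'M[R]_(m1, m2)) :
  frob2 M <= (m1 * m2)%:R * `|M| ^+ 2.
Proof.
rewrite natrM -mulrA -[m1 in m1%:R]card_ord mulr_natl -sumr_const.
apply: ler_sum => i _; rewrite -[m2 in m2%:R]card_ord mulr_natl -sumr_const.
apply: ler_sum => j _; rewrite -real_normK ?num_real//.
by rewrite lerXn2r ?nnegrE// le_mx_norm.
Qed.

Lemma near_frob2 S e : 0 < e -> \forall T \near S, frob2 (S - T) < e.
Proof.
move=> e0; set N : R := (n * n)%:R + 1.
have N0 : 0 < N by rewrite ltr_wpDl.
have r0 : 0 < Num.min 1 (e / N) by rewrite lt_min ltr01 divr_gt0.
have := nbhsx_ballx S _ r0; rewrite -ball_normE.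
apply: (@filterS _ _ (nbhs_filter S)) => T /=; rewrite lt_min => /andP[l1 l2].
apply: le_lt_trans (frob2_le_norm _) _.
apply: (@le_lt_trans _ _ (N * `|S - T|)); last by rewrite mulrC -ltr_pdivlMr.
apply: ler_pM => //; first by rewrite lerDl.
by rewrite expr2 ler_piMl// ltW.
Qed.

(** Near S all eigenvalues are at least c / 2, where c bounds those of S from
    below, and ln is Lipschitz there. *)
Lemma continuous_mxlog : {within @SPD R n, continuous (@mxlog R n)}.
Proof.
apply/subspace_continuousP => S spdS; apply/cvgrPdist_lt => e e0.
have [P [a [OP a0 SE]]] := spd_diagonalizable spdS.
have [c c0 ca] := row_pos_lb a0.
have c2 : 0 < c / 2 by rewrite divr_gt0.
have r0 : 0 < Num.min ((c / 2) ^+ 2) ((c / 2) ^+ 2 * e ^+ 2).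
  by rewrite lt_min (mulr_gt0 (exprn_gt0 2 c2)) exprn_gt0.
have := near_frob2 S r0.
rewrite near_withinE; apply: (@filterS _ _ (nbhs_filter S)) => T.
rewrite lt_min => /andP[l1 l2] /spd_diagonalizable[Q [b [OQ b0 TE]]].
have cb j : c / 2 <= b 0 j.
  have [i Hi] := eigenvalue_close a b j OP OQ; move: Hi.
  rewrite -SE -TE => Hi; have := le_lt_trans Hi l1.
  rewrite -ltr_sqrt ?exprn_gt0// !sqrtr_sqr (gtr0_norm c2) ltr_norml.
  by move=> /andP[_ H1]; have := ca i; lra.
apply: frob2_lt_norm => //.
apply: le_lt_trans (_ : (c / 2) ^- 2 * frob2 (S - T) < _); last first.
  by rewrite mulrC ltr_pdivrMr ?exprn_gt0// mulrC.
rewrite /from_subspace SE TE !mxlogE//; apply: spectral_lipschitz => // i j.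
apply: ln_lipschitz => //; apply: le_trans (ca i).
by rewrite ler_pdivrMr// mulr_natr mulr2n lerDl ltW.
Qed.

(** The difference quotient z h of log along X solves the linear equation
    dexp (log (h X + S)) (log S) (z h) = X.  Completing z by Z at h = 0, where
    the equation holds by hypothesis, the case k = 0 of [class_C_linear_solve]
    with parameter h says that z is continuous at 0. *)
Lemma is_derive_mxlog S X Z : SPD S -> Sym X ->
  dexp (mxlog S) (mxlog S) Z = X -> is_derive S X (@mxlog R n) Z.
Proof.
move=> spdS symX ZX; pose L h := mxlog (h *: X + S).
pose U := [set h : R | SPD (h *: X + S)].
have L0 : L 0 = mxlog S by rewrite /L scale0r add0r.
have U0 : U 0 by rewrite /U /= scale0r add0r.
have Uopen : dir_open setT U.
  move=> h v Uh _; rewrite /U /=.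
  have symvX : Sym (v *: X) by rewrite /Sym /= linearZ /= symX.
  have := spd_dir_open Uh symvX; apply: filterS => t.
  by rewrite addrA scalerDl -scalerA.
have Lsym h : U h -> (L h)^T = L h by move=> Uh; exact: mxlog_sym.
have CL : class_C setT U 0 L.
  split=> //; apply/subspace_continuousP => h Uh.
  have : @mxlog R n @ within (@SPD R n) (nbhs (h *: X + S)) --> L h.
    by move/subspace_continuousP: continuous_mxlog; apply.
  move=> HL; refine (cvg_comp (fun h' : R => h' *: X + S) _ _ HL) => A.
  rewrite /within /= => HA.
  have cX : h' *: X + S @[h' --> h] --> h *: X + S.
    apply: cvgD; last exact: cvg_cst.
    by apply: cvgZ; [exact: cvg_id | exact: cvg_cst].
  change (nbhs (h : R) (fun t : R => U t -> A (t *: X + S))).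
  have HA' : nbhs (h : R) (fun t : R => SPD (t *: X + S) -> A (t *: X + S)).
    exact: cX HA.
  exact: HA'.
pose z (h : R) : 'M[R]_n := if h == 0 then Z else h^-1 *: (L h - L 0).
have Cz : class_C setT U 0 z.
  pose f (h : R) := dexp (L h) (L 0).
  apply: (class_C_linear_solve Uopen (f := f) (w := fun=> X)).
  - move=> Y; apply: (class_C_dexp Uopen CL).
      exact: class_C_cst.
    exact: class_C_cst.
  - exact: class_C_cst.
  - by move=> h Uh; apply: dexp_linear; exact: Lsym.
  - by move=> h Y Uh; apply: dexp_inj; exact: Lsym.
  - move=> h Uh; rewrite /f /z; case: eqVneq => [->|h0]; first by rewrite L0.
    rewrite dexpZ -mexpB L0 !mexp_mxlog// addrK scalerA mulVf// scale1r.
    by [].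
have zZ : z @ (0 : R)^' --> Z.
  have : z @ within U (nbhs 0) --> z 0.
    by case: Cz => /subspace_continuousP/(_ 0 U0).
  rewrite {2}/z eqxx; apply: cvg_trans => A HzA.
  have HA : nbhs (0 : R) (fun h => U h -> A (z h)) by exact: HzA.
  have UX := Uopen 0 1 U0 I.
  have HA' : \forall h \near (0:R)^', U h -> A (z h) by exact: nbhs_dnbhs.
  change (\forall h \near (0 : R)^', A (z h)).
  near=> h; have Ah : U h -> A (z h) by near: h.
  apply: Ah; have : U (h *: 1 + 0) by near: h.
  by rewrite addr0 /GRing.scale /= mulr1.
have lim : h^-1 *: ((@mxlog R n \o shift S) (h *: X) - mxlog S)
    @[h --> (0 : R)^'] --> Z.
  apply: cvg_trans zZ; apply: near_eq_cvg; near=> h.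
  have h0 : h != 0 by near: h; exact: nbhs_dnbhs_neq.
  by rewrite /z (negbTE h0) L0.
by split; [exact: cvgP lim | exact: cvg_lim lim].
Unshelve. all: by end_near. Qed.

Lemma dexp_surj S X : SPD S -> exists Z, dexp (mxlog S) (mxlog S) Z = X.
Proof.
move=> /spd_diagonalizable[P [d [OP d0 ->]]].
pose l : 'rV[R]_n := map_mx (@ln R) d.
exists (P *m (\matrix_(i, j) ((expdd (l 0 i) (l 0 j))^-1 * (P^T *m X *m P) i j))
  *m P^T).
rewrite mxlogE// dexp_spectral// -/l.
rewrite !mulmxA OP mul1mx -[_ *m P^T *m P]mulmxA OP mulmx1.
rewrite (_ : \matrix_(i, j) _ = P^T *m X *m P).
  by rewrite !mulmxA (orthT OP) mul1mx -mulmxA (orthT OP) mulmx1.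
apply/matrixP => i j; rewrite [LHS]mxE [X in _ * X]mxE mulVKf//.
by rewrite gt_eqF// expdd_gt0.
Qed.

Lemma dexp_derive_mxlog S X : SPD S -> Sym X ->
  dexp (mxlog S) (mxlog S) ('D_X (@mxlog R n) S) = X.
Proof.
move=> spdS symX; have [Z ZX] := dexp_surj X spdS.
by have [_ ->] := is_derive_mxlog spdS symX ZX.
Qed.

(** The derivative of log along X solves a linear equation with coefficients of
    the same regularity as log, so the regularity increases by one. *)
Lemma class_C_mxlog k : class_C (@Sym R n) (@SPD R n) k (@mxlog R n).
Proof.
have Uopen := @spd_dir_open R n.
elim: k => [|k IH]; first by split=> //; exact: continuous_mxlog.
apply: class_CS => // [|X symX]; first exact: continuous_mxlog.
exists ('D_X (@mxlog R n)).
  apply: (class_C_linear_solve Uopen (f := fun S => dexp (mxlog S) (mxlog S))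
    (w := fun=> X)) => //.
  - by move=> Y; apply: class_C_dexp => //; exact: class_C_cst.
  - exact: class_C_cst.
  - by move=> S spdS; apply: dexp_linear; exact: mxlog_sym.
  - by move=> S Y spdS; apply: dexp_inj; exact: mxlog_sym.
  - by move=> S spdS; exact: dexp_derive_mxlog.
move=> S spdS; have [Z ZX] := dexp_surj X spdS.
have D := is_derive_mxlog spdS symX ZX.
by apply: derivableP; case: D.
Qed.

Lemma class_C_mxpow k p : class_C (@Sym R n) (@SPD R n) k (@mxpow R n p).
Proof.
have Uopen := @spd_dir_open R n.
have : class_C (@Sym R n) (@SPD R n) k (fun S => mexp (p *: mxlog S)).
  apply: class_C_mexp => //; apply: class_C_scalemx => //;
    last exact: class_C_mxlog.
  exact: class_C_cst.
by apply: class_C_ext => // S spdS; rewrite mxpow_mexp.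
Qed.

(** The slope (x^p - y^p) / (p (x - y)), written so that p = 0 (the slope of ln)
    and x = y need no separate treatment; see [powdd_sub] and [powdd0_sub]. *)
Definition powdd (p x y : R) := expdd (p * ln x) (p * ln y) / expdd (ln x) (ln y).

Lemma derive_mxlog_spectral P d X' : Orth P -> (forall i, 0 < d 0 i) ->
  X'^T = X' -> 'D_(P *m X' *m P^T) (@mxlog R n) (P *m diag_mx d *m P^T) =
  P *m (\matrix_(i, j) (X' i j / expdd (ln (d 0 i)) (ln (d 0 j)))) *m P^T.
Proof.
move=> OP d0 symX'; have spdS := diag_spd OP d0.
have symX : Sym (P *m X' *m P^T).
  by rewrite /Sym /= !trmx_mul trmxK symX' mulmxA.
apply: derive_val; apply: is_derive_mxlog => //.
rewrite mxlogE// dexp_spectral//.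
rewrite !mulmxA OP mul1mx -[_ *m P^T *m P]mulmxA OP mulmx1.
congr (_ *m _ *m _); apply/matrixP => i j; rewrite !mxE mulrCA divff ?mulr1//.
by rewrite gt_eqF// expdd_gt0.
Qed.

Lemma derive_mxpow_spectral p P d X' : Orth P -> (forall i, 0 < d 0 i) ->
  X'^T = X' -> 'D_(P *m X' *m P^T) (@mxpow R n p) (P *m diag_mx d *m P^T) =
  P *m (\matrix_(i, j) (p * powdd p (d 0 i) (d 0 j) * X' i j)) *m P^T.
Proof.
move=> OP d0 symX'; have spdS := diag_spd OP d0.
have symX : Sym (P *m X' *m P^T).
  by rewrite /Sym /= !trmx_mul trmxK symX' mulmxA.
have dlog := class_C_derivable (class_C_mxlog 1) spdS symX.
set S := P *m diag_mx d *m P^T in spdS dlog *.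
set X := P *m X' *m P^T in symX dlog *.
have D : is_derive S X (fun S => mexp (p *: mxlog S))
    (dexp (p *: mxlog S) (p *: mxlog S) (p *: 'D_X (@mxlog R n) S)).
  exact: (is_derive_mexp (is_deriveZ p (derivableP dlog))).
have [_ ->] := is_derive_ext (@spd_dir_open R n) spdS symX
  (fun S spdS => esym (mxpow_mexp p spdS)) D.
rewrite derive_mxlog_spectral// /S mxlogE//.
have -> : p *: (P *m diag_mx (map_mx (@ln R) d) *m P^T) =
    P *m diag_mx (p *: map_mx (@ln R) d) *m P^T.
  by rewrite linearZ /= -scalemxAr -scalemxAl.
rewrite dexpZ dexp_spectral//.
rewrite !mulmxA OP mul1mx -[_ *m P^T *m P]mulmxA OP mulmx1.
rewrite scalemxAl scalemxAr; congr (_ *m _ *m _).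
by apply/matrixP => i j; rewrite !mxE /powdd; ring.
Qed.

End LogPow.

(** * The kernel and its monotonicity *)

Section Kernel.
Context (R : realType).
Implicit Types (p x y : R).

Lemma expdd_shift (a b t : R) : expdd (t + a) (t + b) = expR t * expdd a b.
Proof.
rewrite /expdd (inj_eq (addrI t)); case: eqVneq => [_|ab]; first exact: expRD.
rewrite !expRD opprD addrACA subrr add0r mulrA; congr (_ / _); ring.
Qed.

Lemma expdd_double (a b : R) :
  expdd (2 * a) (2 * b) = expdd a b * ((expR a + expR b) / 2).
Proof.
have two : (2 : R) != 0 by rewrite pnatr_eq0.
have sq (t : R) : expR (2 * t) = expR t ^+ 2.
  by rewrite expRM_natl.
rewrite /expdd (inj_eq (mulfI two)) !sq; case: eqVneq => [->|ab]; first by field.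
by rewrite -mulrBr subr_sqr; field; rewrite subr_eq0 ab.
Qed.

Lemma powR_exp p x : 0 < x -> x `^ p = expR (p * ln x).
Proof. by move=> x0; rewrite /powR gt_eqF. Qed.

Lemma powdd_gt0 p x y : 0 < powdd p x y.
Proof. by rewrite divr_gt0// expdd_gt0. Qed.

Lemma powddC p x y : powdd p x y = powdd p y x.
Proof. by rewrite /powdd expddC [in X in _ / X]expddC. Qed.

Lemma powddxx p x : 0 < x -> powdd p x x = x `^ (p - 1).
Proof. by move=> x0; rewrite /powdd !expddxx -expRB powR_exp// mulrBl mul1r. Qed.

Lemma powdd_sub p x y : 0 < x -> 0 < y ->
  p * (powdd p x y * (x - y)) = x `^ p - y `^ p.
Proof.
move=> x0 y0; have := expddE (ln x) (ln y); rewrite !lnK ?posrE// => <-.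
have := expddE (p * ln x) (p * ln y); rewrite -!powR_exp// => <-.
by rewrite /powdd; field; rewrite gt_eqF// expdd_gt0.
Qed.

Lemma powdd0_sub x y : 0 < x -> 0 < y ->
  powdd 0 x y * (x - y) = ln x - ln y.
Proof.
move=> x0 y0; have := expddE (ln x) (ln y); rewrite !lnK ?posrE// => <-.
rewrite /powdd !mul0r expddxx expR0.
by field; rewrite gt_eqF// expdd_gt0.
Qed.

Lemma powddM p c x y : 0 < c -> 0 < x -> 0 < y ->
  powdd p (c * x) (c * y) = c `^ (p - 1) * powdd p x y.
Proof.
move=> c0 x0 y0; rewrite /powdd !lnM ?posrE// !mulrDr !expdd_shift.
rewrite -powR_exp// lnK ?posrE// powRB; last by rewrite (gt_eqF c0) implybT.
rewrite powRr1 ?ltW//; field.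
by rewrite !gt_eqF// expdd_gt0.
Qed.

Section Slope.
Variables (F f : R -> R) (s : R -> R -> R) (M : R).
Hypothesis dF : forall t : R, 0 < t -> is_derive t 1 F (f t).
Hypothesis fnincr : forall t u : R, 0 < t -> t <= u -> u <= M -> f u <= f t.

Lemma concave_increment u v : 0 < u -> u <= v -> v <= M ->
  f v * (v - u) <= F v - F u <= f u * (v - u).
Proof.
move=> u0 uv vM; move: (uv); rewrite le_eqVlt => /predU1P[->|ltuv].
  by rewrite !subrr !mulr0 lexx.
have [||c] := MVT ltuv (df := f) (f := F).
- by move=> t; rewrite in_itv /= => /andP[ut _]; apply: dF; exact: lt_trans ut.
- apply: continuous_in_subspaceT => t; rewrite inE /= in_itv /= => /andP[ut _].
  apply: differentiable_continuous; apply/derivable1_diffP.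
  by have [] := dF (lt_le_trans u0 ut).
rewrite in_itv /= => /andP[uc cv] ->.
have c0 : 0 < c by exact: lt_trans uc.
have fvc : f v <= f c by exact: fnincr c0 (ltW cv) vM.
have fcu : f c <= f u by exact: fnincr u0 (ltW uc) (le_trans (ltW cv) vM).
by rewrite !ler_wpM2r ?subr_ge0.
Qed.

(** Monotonicity of the slopes s of a function with nonincreasing derivative,
    including the diagonal value f y.  The bound M allows functions that are
    concave only up to M. *)
Lemma slope_nincr x x' y : (s x y * (x - y) = F x - F y) ->
  (s x' y * (x' - y) = F x' - F y) -> s y y = f y ->
  0 < x -> 0 < y -> x <= x' -> x' <= M -> y <= M -> s x' y <= s x y.
Proof.
move=> sx sx' sy x0 y0 xx' x'M yM.
have x'0 : 0 < x' by exact: lt_le_trans xx'.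
have xM : x <= M by exact: le_trans x'M.
have ge_low t : 0 < t -> t <= y -> s t y * (t - y) = F t - F y ->
    f y <= s t y <= f t.
  move=> t0; rewrite le_eqVlt => /predU1P[-> _|ty H]; first by rewrite sy lexx.
  have := concave_increment t0 (ltW ty) yM.
  have -> : F y - F t = s t y * (y - t) by rewrite -opprB -H; ring.
  by rewrite !ler_pM2r ?subr_gt0.
have le_up t : y <= t -> t <= M -> s t y * (t - y) = F t - F y ->
    f t <= s t y <= f y.
  rewrite le_eqVlt => /predU1P[<- _ _|ty tM H]; first by rewrite sy lexx.
  have := concave_increment y0 (ltW ty) tM.
  by rewrite -H !ler_pM2r ?subr_gt0.
have inc := concave_increment x0 xx' x'M.
(* Cases y < x, then x <= y <= x', then x' < y. *)
have [xy|yx] := leP x y; last first.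
  have yx' : y < x' by exact: lt_le_trans xx'.
  have /andP[l _] := le_up _ (ltW yx) xM sx.
  rewrite -(ler_pM2r (_ : 0 < x' - y)) ?subr_gt0// sx'.
  have /andP[_ i] := inc.
  have -> : F x' - F y = (F x' - F x) + s x y * (x - y) by rewrite sx; ring.
  have -> : s x y * (x' - y) = s x y * (x' - x) + s x y * (x - y) by ring.
  by rewrite lerD2r (le_trans i)// ler_wpM2r// subr_ge0.
have [yx'|x'y] := leP y x'.
  have /andP[l _] := ge_low _ x0 xy sx.
  have /andP[_ l'] := le_up _ yx' x'M sx'.
  exact: le_trans l' l.
have /andP[_ l] := ge_low _ x'0 (ltW x'y) sx'.
have /andP[i _] := inc.
have xy' : x < y by exact: le_lt_trans xx' x'y.
rewrite -(ler_pM2r (_ : 0 < y - x)) ?subr_gt0//.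
have -> : s x y * (y - x) = (F x' - F x) + s x' y * (y - x').
  have -> : s x' y * (y - x') = - (s x' y * (x' - y)) by ring.
  by rewrite sx' -opprB mulrN sx; ring.
have -> : s x' y * (y - x) = s x' y * (x' - x) + s x' y * (y - x') by ring.
by rewrite lerD2r (le_trans _ i)// ler_wpM2r// subr_ge0.
Qed.

End Slope.

Lemma le0_powR_nincr p x x' : p <= 0 -> 0 < x -> x <= x' -> x' `^ p <= x `^ p.
Proof.
move=> p0 x0 xx'; have x'0 : 0 < x' by exact: lt_le_trans xx'.
by rewrite !powR_exp// ler_expR ler_wnM2l// ler_ln.
Qed.

Lemma ge0_powR_ndecr p x x' : 0 <= p -> 0 < x -> x <= x' -> x `^ p <= x' `^ p.
Proof.
move=> p0 x0 xx'; have x'0 : 0 < x' by exact: lt_le_trans xx'.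
by rewrite !powR_exp// ler_expR ler_wpM2l// ler_ln.
Qed.

(** For p <= 1 the function t^p / p, or ln t, is concave and [powdd] is its
    slope. *)
Lemma powdd_nincr p x x' y : p <= 1 -> 0 < x -> 0 < y -> x <= x' ->
  powdd p x' y <= powdd p x y.
Proof.
move=> p1 x0 y0 xx'; have x'0 : 0 < x' by exact: lt_le_trans xx'.
pose F t := if p == 0 then ln t else p^-1 * t `^ p.
have FE u v : 0 < u -> 0 < v -> powdd p u v * (u - v) = F u - F v.
  move=> u0 v0; rewrite /F; case: eqVneq => [->|pn0]; first exact: powdd0_sub.
  by rewrite -mulrBr -powdd_sub// mulKf.
apply: (@slope_nincr F (fun t => t `^ (p - 1)) (powdd p) (Num.max x' y)) => //.
- move=> t t0; rewrite /F; case: eqVneq => [->|pn0].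
    by rewrite sub0r powRN powRr1 ?ltW//; exact: is_derive1_ln.
  have := is_deriveZ p^-1 (is_derive1_powR p t0).
  by rewrite /GRing.scale /= mulKf.
- by move=> t u t0 tu _; apply: le0_powR_nincr => //; rewrite subr_le0.
- exact: FE.
- exact: FE.
- exact: powddxx.
- by rewrite le_max lexx.
- by rewrite le_max lexx orbT.
Qed.

(** The kernel of the power-Wasserstein metric, see
    [power_wasserstein_spectral]. *)
Definition pw_kernel p x y : R := 2 * (x `^ p + y `^ p) / powdd p x y ^+ 2.

Lemma pw_kernel_gt0 p x y : 0 < x -> 0 < y -> 0 < pw_kernel p x y.
Proof.
move=> x0 y0; rewrite divr_gt0 ?exprn_gt0 ?powdd_gt0// mulr_gt0//.
by rewrite addr_gt0// powR_gt0.
Qed.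

Lemma pw_kernelC p x y : pw_kernel p x y = pw_kernel p y x.
Proof. by rewrite /pw_kernel powddC addrC. Qed.

Lemma pw_kernelxx p x : 0 < x -> pw_kernel p x x = 4 * x `^ (2 - p).
Proof.
move=> x0; rewrite /pw_kernel powddxx// !powRB ?(gt_eqF x0) ?implybT//.
rewrite powRr1 ?ltW//.
have -> : x `^ 2 = x ^+ 2 by rewrite -powR_mulrn ?ltW.
by field; rewrite !gt_eqF// powR_gt0.
Qed.

Lemma pw_kernelM p c x y : 0 < c -> 0 < x -> 0 < y ->
  pw_kernel p (c * x) (c * y) = c `^ (2 - p) * pw_kernel p x y.
Proof.
move=> c0 x0 y0; rewrite /pw_kernel powddM// !powRM ?ltW//.
rewrite !powRB ?(gt_eqF c0) ?implybT// powRr1 ?ltW//.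
have -> : c `^ 2 = c ^+ 2 by rewrite -powR_mulrn ?ltW.
by field; rewrite !gt_eqF// ?powdd_gt0// powR_gt0.
Qed.

Lemma ler_div_sqr (a b c d : R) : 0 <= a -> a <= b -> 0 < d -> d <= c ->
  a / c ^+ 2 <= b / d ^+ 2.
Proof.
move=> a0 ab d0 dc; have c0 : 0 < c by exact: lt_le_trans dc.
apply: ler_pM => //; first by rewrite invr_ge0 exprn_ge0// ltW.
rewrite lef_pV2 ?posrE ?exprn_gt0//; apply: lerXn2r => //; rewrite nnegrE;
  exact: ltW.
Qed.

Lemma pw_kernel_ndecr_ge0 p x x' y : 0 <= p -> p <= 1 ->
  0 < x -> 0 < y -> x <= x' -> pw_kernel p x y <= pw_kernel p x' y.
Proof.
move=> p0 p1 x0 y0 xx'; apply: ler_div_sqr; rewrite ?powdd_gt0 ?powdd_nincr//.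
  by rewrite mulr_ge0 ?addr_ge0 ?powR_ge0.
by rewrite ler_wpM2l// lerD2r ge0_powR_ndecr.
Qed.

Lemma powdd_half p x y : 0 < x -> 0 < y ->
  powdd p x y = powdd (p / 2) x y * ((x `^ (p / 2) + y `^ (p / 2)) / 2).
Proof.
move=> x0 y0; rewrite /powdd.
have pE (t : R) : p * t = 2 * (p / 2 * t) by field.
by rewrite (pE (ln x)) (pE (ln y)) expdd_double -!powR_exp// mulrAC.
Qed.

Lemma powR_half p x : 0 < x -> x `^ p = (x `^ (p / 2)) ^+ 2.
Proof.
move=> x0; rewrite expr2 -powRD; last by rewrite (gt_eqF x0) implybT.
by congr (_ `^ _); field.
Qed.

(** Above the diagonal, with X = x^(p/2) <= Y = y^(p/2), the slope of exponent p
    is the slope of exponent p/2 times (X + Y) / 2.  What remains is the quotient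
    (X^2 + Y^2) / (X + Y)^2, which increases as X moves down away from Y. *)
Lemma pw_kernel_ndecr_lt0_ge p x x' y : p < 0 ->
  0 < y -> y <= x -> x <= x' -> pw_kernel p x y <= pw_kernel p x' y.
Proof.
move=> p0 y0 yx xx'; have x0 : 0 < x by exact: lt_le_trans yx.
have x'0 : 0 < x' by exact: lt_le_trans xx'.
have r0 : p / 2 <= 0 by rewrite pmulr_lle0 ?invr_gt0 ?ltW.
have kE t : 0 < t -> pw_kernel p t y =
   (8 * ((t `^ (p / 2)) ^+ 2 + (y `^ (p / 2)) ^+ 2) /
    (t `^ (p / 2) + y `^ (p / 2)) ^+ 2) / powdd (p / 2) t y ^+ 2.
  move=> t0; rewrite /pw_kernel powdd_half// !(powR_half p)//.
  field; rewrite !gt_eqF ?powdd_gt0//; last by rewrite addr_gt0 ?powR_gt0.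
rewrite !kE//; apply: ler_div_sqr; rewrite ?powdd_gt0//.
- by rewrite divr_ge0 ?sqr_ge0// mulr_ge0// addr_ge0 ?sqr_ge0.
- have X'0 : 0 < x' `^ (p / 2) by rewrite powR_gt0.
  have Y0 : 0 < y `^ (p / 2) by rewrite powR_gt0.
  have X'X : x' `^ (p / 2) <= x `^ (p / 2) by exact: le0_powR_nincr.
  have XY : x `^ (p / 2) <= y `^ (p / 2) by exact: le0_powR_nincr.
  move: (x' `^ _) (x `^ _) (y `^ _) X'0 Y0 X'X XY => X' X Y X'0 Y0 X'X XY.
  have X0 : 0 < X by exact: lt_le_trans X'X.
  rewrite ler_pdivrMr ?exprn_gt0 ?addr_gt0// mulrAC.
  rewrite ler_pdivlMr ?exprn_gt0 ?addr_gt0//.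
  rewrite -subr_ge0.
  rewrite (_ : _ - _ = 16 * Y * (X - X') * (Y ^+ 2 - X * X')); last by ring.
  have XX' : X * X' <= Y ^+ 2.
    rewrite expr2; apply: ler_pM => //;
      [exact: ltW|exact: ltW|exact: le_trans XY].
  by rewrite mulr_ge0 ?subr_ge0// mulr_ge0 ?subr_ge0// mulr_ge0 ?ltW.
- by apply: powdd_nincr => //; lra.
Qed.

(** Below the diagonal, dividing numerator and denominator by (x y)^p makes the
    numerator x^(-p) + y^(-p), which is increasing, and turns the slope into
    that of F t = ((t/y)^(p/2) - (t/y)^(-p/2)) / p.  With w = ln (y/t), its
    derivative is cosh (p w / 2) / t, a product of nonincreasing functions
    for t <= y. *)
Lemma pw_kernel_ndecr_lt0_le p x x' y : p < 0 ->
  0 < x -> x <= x' -> x' <= y -> pw_kernel p x y <= pw_kernel p x' y.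
Proof.
move=> p0 x0 xx' x'y; have x'0 : 0 < x' by exact: lt_le_trans xx'.
have y0 : 0 < y by exact: lt_le_trans x'y.
pose r := p / 2; have r0 : r <= 0 by rewrite pmulr_lle0 ?invr_gt0 ?ltW.
have pn0 : p != 0 by rewrite lt_eqF.
have pr (t : R) : 0 < t -> 0 < t `^ r by move=> t0; rewrite powR_gt0.
pose s u v := powdd p u v / (u `^ r * v `^ r).
have kE t : 0 < t -> pw_kernel p t y =
    2 * (t `^ (- p) + y `^ (- p)) / s t y ^+ 2.
  move=> t0; rewrite /pw_kernel /s !powRN !(powR_half p)// -/r.
  by field; rewrite !gt_eqF ?powdd_gt0 ?pr.
rewrite !kE//; apply: ler_div_sqr.
- by rewrite mulr_ge0// addr_ge0 ?powR_ge0.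
- by rewrite ler_wpM2l// lerD2r ge0_powR_ndecr// oppr_ge0 ltW.
- by rewrite divr_gt0 ?powdd_gt0 ?mulr_gt0 ?pr.
pose F t := p^-1 * ((y `^ r)^-1 * t `^ r - y `^ r * t `^ (- r)).
pose f t := t^-1 * ((t `^ r / y `^ r + y `^ r / t `^ r) / 2).
have FE u : 0 < u -> s u y * (u - y) = F u - F y.
  move=> u0; have := powdd_sub p u0 y0; rewrite !(powR_half p)// -/r => H.
  apply: (mulfI pn0); rewrite /s /F mulrAC mulrA H !powRN.
  by field; rewrite pn0 !gt_eqF ?pr.
apply: (@slope_nincr F f s y) => //; [| |exact: FE|exact: FE|].
- move=> t t0.
  have D1 := is_derive1_powR r t0; have D2 := is_derive1_powR (- r) t0.
  have := is_deriveZ p^-1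
    (is_deriveB (is_deriveZ (y `^ r)^-1 D1) (is_deriveZ (y `^ r) D2)).
  rewrite (_ : p^-1 *: _ = f t); last first.
    rewrite /GRing.scale /= /f !powRB ?(gt_eqF t0) ?implybT// powRN powRr1 ?ltW//.
    by rewrite /r; field; rewrite pn0 !gt_eqF ?pr.
  exact.
- move=> t u t0 tu uy; have u0 : 0 < u by exact: lt_le_trans tu.
  apply: ler_pM.
  + by rewrite invr_ge0 ltW.
  + by apply: ltW; rewrite divr_gt0// addr_gt0// divr_gt0 ?pr.
  + by rewrite lef_pV2.
  rewrite ler_pM2r ?invr_gt0//.
  have Yu : y `^ r <= u `^ r by exact: le0_powR_nincr.
  have ut : u `^ r <= t `^ r by exact: le0_powR_nincr.
  move: (y `^ r) (u `^ r) (t `^ r) (pr y y0) Yu ut => Y U T Y0 YU UT.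
  have U0 : 0 < U by exact: lt_le_trans YU.
  have T0 : 0 < T by exact: lt_le_trans UT.
  rewrite -subr_ge0.
  rewrite (_ : _ - _ = (T - U) * (T * U - Y ^+ 2) / (Y * T * U)); last first.
    by field; rewrite !gt_eqF.
  have YTU : Y ^+ 2 <= T * U.
    by rewrite expr2; apply: ler_pM; [exact: ltW|exact: ltW|exact: le_trans UT|].
  rewrite divr_ge0 ?mulr_ge0 ?subr_ge0//; exact: ltW.
- rewrite /s /f powddxx// powRB ?(gt_eqF y0) ?implybT// powRr1 ?ltW//.
  by rewrite (powR_half p)// -/r; field; rewrite !gt_eqF ?pr.
Qed.

Lemma pw_kernel_ndecr p x x' y : p <= 1 ->
  0 < x -> 0 < y -> x <= x' -> pw_kernel p x y <= pw_kernel p x' y.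
Proof.
move=> p1 x0 y0 xx'; have [p0|p0] := leP 0 p; first exact: pw_kernel_ndecr_ge0.
have [yx|/ltW xy] := leP y x; first exact: pw_kernel_ndecr_lt0_ge.
have [yx'|/ltW x'y] := leP y x'; last exact: pw_kernel_ndecr_lt0_le.
apply: (@le_trans _ _ (pw_kernel p y y)); first exact: pw_kernel_ndecr_lt0_le.
exact: pw_kernel_ndecr_lt0_ge.
Qed.

Lemma pw_kernel_mean_form p : p <= 1 -> mean_form (pw_kernel p).
Proof.
move=> p1; have t0 : 0 < 2 - p by lra.
pose m x y := (pw_kernel p x y / 4) `^ (2 - p)^-1.
have k0 x y : 0 < x -> 0 < y -> 0 < pw_kernel p x y / 4.
  by move=> x0 y0; rewrite divr_gt0 ?pw_kernel_gt0.
have mxx x : 0 < x -> m x x = x.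
  move=> x0; rewrite /m pw_kernelxx// [4 * _]mulrC mulfK// -powRrM.
  rewrite mulfV ?gt_eqF//.
  by rewrite powRr1 ?ltW.
have mC x y : m x y = m y x by rewrite /m pw_kernelC.
have mle1 x x' y : 0 < x -> 0 < y -> x <= x' -> m x y <= m x' y.
  move=> x0 y0 xx'; apply: ge0_powR_ndecr; [by rewrite invr_ge0 ltW|exact: k0|].
  by rewrite ler_wpM2r// pw_kernel_ndecr.
have mle x x' y y' : 0 < x -> 0 < y -> x <= x' -> y <= y' -> m x y <= m x' y'.
  move=> x0 y0 xx' yy'; apply: (@le_trans _ _ (m x' y)); first exact: mle1.
  rewrite mC [leRHS]mC; apply: mle1 => //; exact: lt_le_trans xx'.
exists 4, (2 - p), m; split=> //.
- split; first by move=> x y x0 y0; rewrite powR_gt0// k0.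
  split=> //.
    move=> c x y c0 x0 y0; rewrite /m pw_kernelM// -mulrA powRM ?powR_ge0//.
      by rewrite -powRrM mulfV ?gt_eqF// powRr1 ?ltW.
    by rewrite ltW// k0.
  move=> x y x0 y0.
  have min0 : 0 < Num.min x y by rewrite lt_min x0.
  have max0 : 0 < Num.max x y by rewrite lt_max x0.
  apply/andP; split.
    by rewrite -[leLHS](mxx _ min0) mle// ge_min lexx ?orbT.
  by rewrite -[leRHS](mxx _ max0) mle// le_max lexx ?orbT.
- move=> x y x0 y0; rewrite /m -powRrM mulVf ?gt_eqF// powRr1 ?ltW ?k0//.
  by field.
Qed.

End Kernel.

(** * Smoothness of the kernel *)

Section KernelSmooth.
Context (R : realType).

(** A directional derivative is a derivative of a function of one real variable,
    for which the chain rule is available. *)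
Lemma is_derive_ln_comp (V : normedModType R) (f : V -> R) x v l :
  0 < f x -> is_derive x v f l -> is_derive x v (fun y => ln (f y)) (l / f x).
Proof.
move=> fx0 [df fl].
have lineE (g : V -> R) : (fun h : R => h^-1 *: ((g \o shift x) (h *: v) - g x)) =
    (fun h : R => h^-1 *: (((fun t : R => g (t *: v + x)) \o shift 0) (h *: 1)
       - g (0 *: v + x))).
  by apply/funext => h /=; rewrite addr0 scale0r add0r [h *: 1]mulr1.
have dg : is_derive (0 : R) 1 (fun t : R => f (t *: v + x)) l.
  by split; [rewrite /derivable -lineE | rewrite /derive -lineE].
have f0 : f (0 *: v + x) = f x by rewrite scale0r add0r.
have f00 : 0 < f (0 *: v + x) by rewrite f0.
have [d1 d2] := is_derive1_comp (is_derive1_ln f00) dg.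
split; first by rewrite /derivable lineE; exact: d1.
have -> : l / f x = (f (0 *: v + x))^-1 * l by rewrite f0 mulrC.
by rewrite /derive lineE; exact: d2.
Qed.

Section Class.
Variables (V : normedModType R) (E U : set V).
Hypothesis Uopen : dir_open E U.

Lemma class_C_ln k (f : V -> R) : class_C E U k f -> (forall x, U x -> 0 < f x) ->
  class_C E U k (fun x => ln (f x)).
Proof.
move=> fk f0.
have C0 : {within U, continuous (fun x => ln (f x))}.
  move/class_C_continuous/subspace_continuousP: fk => fc.
  apply/subspace_continuousP => x Ux.
  exact: (cvg_comp _ _ (fc x Ux) (continuous_ln (f0 x Ux))).
elim: k fk => [|k IH] fk; first by split.
apply: class_CS => // v Ev.
exists (fun x => 'D_v f x * (f x)^-1).
  apply: class_CM => //; first exact: class_C_derive fk Ev.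
  apply: class_CV => //; first exact: class_CW.
  by move=> x /f0; rewrite lt0r => /andP[].
move=> x Ux; apply: is_derive_ln_comp; first exact: f0.
by apply: derivableP; exact: class_C_derivable fk Ux Ev.
Qed.

(** A divided difference of exp is the corner entry of the exponential of a
    2 x 2 matrix. *)
Lemma class_C_expdd k (a b : V -> R) : class_C E U k a -> class_C E U k b ->
  class_C E U k (fun x => expdd (a x) (b x)).
Proof.
move=> ak bk.
have Cd (c : V -> R) : class_C E U k c ->
    class_C E U k (fun x => diag_mx (const_mx (c x) : 'rV[R]_1)).
  move=> ck; apply/(class_C_mx Uopen) => i j.
  by apply: (class_C_ext Uopen _ ck) => x _; rewrite !mxE !ord1 eqxx mulr1n.
have /(class_C_mx Uopen)/(_ 0 0) := class_C_dexp Uopen (Cd a ak) (Cd b bk)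
  (class_C_cst Uopen k (const_mx 1 : 'M[R]_1)).
apply: (class_C_ext Uopen) => x _.
by rewrite dexp_diag mxE !(mxE const_mx_key) mulr1.
Qed.

Lemma class_C_pw_kernel k p (a b : V -> R) :
  class_C E U k a -> class_C E U k b ->
  (forall x, U x -> 0 < a x) -> (forall x, U x -> 0 < b x) ->
  class_C E U k (fun x => pw_kernel p (a x) (b x)).
Proof.
move=> ak bk a0 b0.
have la := class_C_ln ak a0; have lb := class_C_ln bk b0.
have pl (c : V -> R) : class_C E U k c -> class_C E U k (fun x => p * c x).
  by move=> ck; apply: class_CM => //; exact: class_C_cst.
have pw (c : V -> R) : class_C E U k c -> (forall x, U x -> 0 < c x) ->
    class_C E U k (fun x => c x `^ p).
  move=> ck c0; have pc := pl _ (class_C_ln ck c0).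
  apply: (class_C_ext Uopen _ (class_C_expdd pc pc)) => x Ux.
  by rewrite expddxx powR_exp// c0.
have ld : class_C E U k (fun x => powdd p (a x) (b x)).
  apply: (class_CM Uopen (class_C_expdd (pl _ la) (pl _ lb))).
  apply: (class_CV Uopen (class_C_expdd la lb)) => x _.
  by rewrite gt_eqF// expdd_gt0.
have : class_C E U k (fun x => 2 * (a x `^ p + b x `^ p) *
    (powdd p (a x) (b x) * powdd p (a x) (b x))^-1).
  apply: (class_CM Uopen).
    apply: (class_CM Uopen (class_C_cst Uopen k (2 : R))).
    exact: (class_CD Uopen (pw _ ak a0) (pw _ bk b0)).
  apply: (class_CV Uopen (class_CM Uopen ld ld)) => x _.
  by rewrite mulf_neq0// gt_eqF// powdd_gt0.
by apply: (class_C_ext Uopen) => x _; rewrite /pw_kernel expr2.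
Qed.

End Class.

Lemma quadrant_dir_open : dir_open setT (@pos_quadrant R).
Proof.
move=> [x y] [u v] [/= x0 y0] _.
have pos (a b : R) : 0 < a -> \forall h \near (0 : R)^', 0 < h * b + a.
  move=> a0.
  have H : h * b + a @[h --> (0 : R)^'] --> 0 * b + a.
    apply: cvgD; last exact: cvg_cst.
    by apply: cvgM; [exact: cvg_within|exact: cvg_cst].
  by apply: (cvgr_gt _ H); rewrite mul0r add0r.
near=> h; split=> /=; near: h; exact: pos.
Unshelve. all: by end_near. Qed.

Lemma pw_kernel_kernel_map p : kernel_map (@pw_kernel R p).
Proof.
split; [exact: pw_kernel_gt0 | by move=> x y _ _; exact: pw_kernelC |].
have Uopen := quadrant_dir_open.
have C1 k : class_C setT (@pos_quadrant R) k (fun z : R * R => z.1).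
  case: k => [|k].
    by split=> //; apply: continuous_subspaceT => z; exact: cvg_fst.
  apply: class_CS => // [|v _].
    by apply: continuous_subspaceT => z; exact: cvg_fst.
  exists (fun=> v.1); first exact: class_C_cst.
  move=> z _.
  have L : h^-1 *: ((h *: v + z).1 - z.1) @[h --> (0 : R)^'] --> v.1.
    apply: (@cvg_trans _ ((fun=> v.1) @ (0 : R)^')); last exact: cvg_cst.
    apply: near_eq_cvg; near=> h.
    by rewrite /= addrK scalerA mulVf ?scale1r//; near: h; exact: nbhs_dnbhs_neq.
  by split; [exact: cvgP L|exact: cvg_lim L].
have C2 k : class_C setT (@pos_quadrant R) k (fun z : R * R => z.2).
  case: k => [|k].
    by split=> //; apply: continuous_subspaceT => z; exact: cvg_snd.
  apply: class_CS => // [|v _].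
    by apply: continuous_subspaceT => z; exact: cvg_snd.
  exists (fun=> v.2); first exact: class_C_cst.
  move=> z _.
  have L : h^-1 *: ((h *: v + z).2 - z.2) @[h --> (0 : R)^'] --> v.2.
    apply: (@cvg_trans _ ((fun=> v.2) @ (0 : R)^')); last exact: cvg_cst.
    apply: near_eq_cvg; near=> h.
    by rewrite /= addrK scalerA mulVf ?scale1r//; near: h; exact: nbhs_dnbhs_neq.
  by split; [exact: cvgP L|exact: cvg_lim L].
by move=> k; apply: class_C_pw_kernel => // z [].
Unshelve. all: by end_near. Qed.

End KernelSmooth.

(** * The metric in an eigenbasis *)

Section Metric.
Context (R : realType) (n : nat).
Implicit Types (P S X Y : 'M[R]_n) (d s : 'rV[R]_n).

Lemma orth_conjK P X : Orth P -> P *m (P^T *m X *m P) *m P^T = X.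
Proof.
by move=> /orthT OP; rewrite !mulmxA OP mul1mx -mulmxA OP mulmx1.
Qed.

Lemma orth_conjTK P X : Orth P -> P^T *m (P *m X *m P^T) *m P = X.
Proof. by move=> OP; rewrite !mulmxA OP mul1mx -mulmxA OP mulmx1. Qed.

Lemma orth_mulmx P X Y : Orth P ->
  (P *m X *m P^T) *m (P *m Y *m P^T) = P *m (X *m Y) *m P^T.
Proof.
by move=> OP; rewrite !mulmxA -[_ *m P^T *m P]mulmxA OP mulmx1.
Qed.

Lemma orth_mxtrace P X : Orth P -> \tr (P *m X *m P^T) = \tr X.
Proof. by move=> OP; rewrite mxtrace_mulC mulmxA OP mul1mx. Qed.

Lemma sylvester_inj S Y : SPD S -> S *m Y + Y *m S = 0 -> Y = 0.
Proof.
move=> /spd_diagonalizable[P [s [OP s0 ->]]] H.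
suff Y0 : P^T *m Y *m P = 0 by rewrite -(orth_conjK Y OP) Y0 mulmx0 mul0mx.
have : diag_mx s *m (P^T *m Y *m P) + (P^T *m Y *m P) *m diag_mx s = 0.
  move/(congr1 (fun M => P^T *m M *m P)): H.
  rewrite -{1 2}(orth_conjK Y OP) !orth_mulmx// -mulmxDl -mulmxDr orth_conjTK//.
  by rewrite mulmx0 mul0mx.
rewrite mul_diag_mx mul_mx_diag; move: (P^T *m Y *m P) => Y' H'.
apply/matrixP => i j; move/matrixP/(_ i j): H'; rewrite !mxE => H'.
have : (s 0 i + s 0 j) * Y' i j = 0 by rewrite mulrDl [X in _ + X]mulrC.
by move/eqP; rewrite mulf_eq0 gt_eqF ?addr_gt0//= => /eqP.
Qed.

Lemma sylvester_spectral P s X' : Orth P -> (forall i, 0 < s 0 i) ->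
  X'^T = X' ->
  sylvester (P *m diag_mx s *m P^T) (P *m X' *m P^T) =
  P *m (\matrix_(i, j) (X' i j / (s 0 i + s 0 j))) *m P^T.
Proof.
move=> OP s0 symX; have spdS := diag_spd OP s0.
set Z := \matrix_(i, j) _.
have sol : Sym (P *m Z *m P^T) /\ P *m X' *m P^T =
    (P *m diag_mx s *m P^T) *m (P *m Z *m P^T) +
    (P *m Z *m P^T) *m (P *m diag_mx s *m P^T).
  split.
    rewrite /Sym /= !trmx_mul trmxK mulmxA (_ : Z^T = Z)//.
    by apply/matrixP => i j; rewrite !mxE -{1}symX mxE [s 0 j + _]addrC.
  rewrite !orth_mulmx// -mulmxDl -mulmxDr; congr (_ *m _ *m _).
  rewrite mul_diag_mx mul_mx_diag; apply/matrixP => i j; rewrite !mxE.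
  by field; rewrite gt_eqF// addr_gt0.
rewrite /sylvester; case: xgetP => [Y _ [_ YE]|/(_ (P *m Z *m P^T)) []//].
apply/eqP; rewrite -subr_eq0; apply/eqP; apply: (sylvester_inj spdS).
rewrite mulmxBr mulmxBl addrACA -opprD -YE -sol.2 subrr.
by [].
Qed.

Lemma sylvester_eq S X : SPD S -> Sym X ->
  S *m sylvester S X + sylvester S X *m S = X.
Proof.
move=> /spd_diagonalizable[P [s [OP s0 ->]]] symX.
have symX' : (P^T *m X *m P)^T = P^T *m X *m P.
  by rewrite !trmx_mul trmxK symX mulmxA.
rewrite -{1 2}(orth_conjK X OP) sylvester_spectral// !orth_mulmx//.
rewrite -mulmxDl -mulmxDr -[RHS](orth_conjK X OP); congr (_ *m _ *m _).
rewrite mul_diag_mx mul_mx_diag; apply/matrixP => i j.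
move: (P^T *m X *m P) => X'; rewrite !mxE.
by field; rewrite gt_eqF// addr_gt0.
Qed.

(** The trace has weights s_i / (s_i + s_j)^2; exchanging i and j replaces s_i by
    s_j, and averaging both forms leaves 1 / (2 (s_i + s_j)). *)
Lemma bures_wasserstein_spectral P s X' Y' : Orth P -> (forall i, 0 < s 0 i) ->
  X'^T = X' -> Y'^T = Y' ->
  bures_wasserstein (P *m diag_mx s *m P^T) (P *m X' *m P^T) (P *m Y' *m P^T) =
  \sum_i \sum_j X' i j * Y' i j / (2 * (s 0 i + s 0 j)).
Proof.
move=> OP s0 symX symY.
rewrite /bures_wasserstein !sylvester_spectral// !orth_mulmx// orth_mxtrace//.
have -> : \tr (diag_mx s *m (\matrix_(i, j) (X' i j / (s 0 i + s 0 j)) *m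
      \matrix_(i, j) (Y' i j / (s 0 i + s 0 j)))) =
    \sum_i \sum_j s 0 i * (X' i j * Y' i j / (s 0 i + s 0 j) ^+ 2).
  apply: eq_bigr => i _; rewrite mul_diag_mx !mxE mulr_sumr.
  apply: eq_bigr => j _; rewrite !mxE.
  have -> : Y' j i = Y' i j by rewrite -{1}symY mxE.
  by field; rewrite !gt_eqF// addr_gt0.
set T := \sum_i \sum_j _.
have TT : T = \sum_i \sum_j s 0 j * (X' i j * Y' i j / (s 0 i + s 0 j) ^+ 2).
  rewrite /T exchange_big /=; apply: eq_bigr => i _; apply: eq_bigr => j _.
  have -> : X' j i = X' i j by rewrite -{1}symX mxE.
  have -> : Y' j i = Y' i j by rewrite -{1}symY mxE.
  by rewrite [s 0 j + _]addrC.
have two : (2 : R) != 0 by rewrite pnatr_eq0.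
apply: (mulfI two); rewrite mulr2n mulrDl mul1r {2}TT /T -big_split mulr_sumr /=.
apply: eq_bigr => i _; rewrite -big_split mulr_sumr /=.
apply: eq_bigr => j _.
by field; rewrite gt_eqF// addr_gt0.
Qed.

Lemma power_wasserstein_spectral p P d X' Y' :
  Orth P -> (forall i, 0 < d 0 i) -> X'^T = X' -> Y'^T = Y' ->
  power_wasserstein p (P *m diag_mx d *m P^T) (P *m X' *m P^T) (P *m Y' *m P^T) =
  \sum_i \sum_j (X' i j * Y' i j) / pw_kernel p (d 0 i) (d 0 j).
Proof.
move=> OP d0 symX symY; rewrite /power_wasserstein.
have symM (f : R -> R -> R) (W : 'M[R]_n) : (forall x y, f x y = f y x) ->
    W^T = W ->
    (\matrix_(i, j) (f (d 0 i) (d 0 j) * W i j))^T =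
     \matrix_(i, j) (f (d 0 i) (d 0 j) * W i j).
  by move=> fC symW; apply/matrixP => i j; rewrite !mxE fC -{1}symW mxE.
case: eqVneq => [->|p0].
  rewrite !derive_mxlog_spectral//.
  have -> : (1%:M : 'M[R]_n) = P *m diag_mx (const_mx 1) *m P^T.
    by rewrite diag_const_mx mulmx1 orthT.
  have symL (W : 'M[R]_n) : W^T = W ->
      (\matrix_(i, j) (W i j / expdd (ln (d 0 i)) (ln (d 0 j))))^T =
      \matrix_(i, j) (W i j / expdd (ln (d 0 i)) (ln (d 0 j))).
    by move=> symW; apply/matrixP => i j; rewrite !mxE expddC -{1}symW mxE.
  rewrite bures_wasserstein_spectral ?symL// => [|i]; last by rewrite mxE.
  apply: eq_bigr => i _; apply: eq_bigr => j _; rewrite !mxE.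
  rewrite /pw_kernel /powdd !powRr0 !mul0r expddxx expR0.
  by field; rewrite gt_eqF// expdd_gt0.
rewrite !derive_mxpow_spectral// mxpowE//.
rewrite bures_wasserstein_spectral//; last 3 first.
- by move=> i; rewrite mxE powR_gt0.
- by apply: (symM (fun x y => p * powdd p x y)) => // x y; rewrite powddC.
- by apply: (symM (fun x y => p * powdd p x y)) => // x y; rewrite powddC.
rewrite mulr_sumr; apply: eq_bigr => i _.
rewrite mulr_sumr; apply: eq_bigr => j _; rewrite !mxE /pw_kernel.
by field; rewrite p0 !gt_eqF// ?powdd_gt0// addr_gt0// powR_gt0.
Qed.

Lemma sym_conj P X : Sym X -> (P^T *m X *m P)^T = P^T *m X *m P.
Proof. by move=> symX; rewrite !trmx_mul trmxK symX mulmxA. Qed.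

Lemma power_wasserstein_eigen p S : SPD S ->
  exists P d, [/\ Orth P, (forall i, 0 < d 0 i), S = P *m diag_mx d *m P^T &
  forall X Y, Sym X -> Sym Y -> power_wasserstein p S X Y =
    \sum_i \sum_j ((P^T *m X *m P) i j * (P^T *m Y *m P) i j)
      / pw_kernel p (d 0 i) (d 0 j)].
Proof.
move=> /spd_diagonalizable[P [d [OP d0 SE]]]; exists P, d; split=> //.
move=> X Y symX symY.
rewrite -(power_wasserstein_spectral p OP d0 (sym_conj P symX) (sym_conj P symY)).
by rewrite !orth_conjK// -SE.
Qed.

(** For S positive definite, Y |-> S Y + Y S is injective on all matrices, so the
    solution is given by Cramer's rule. *)
Lemma class_C_sylvester k (T W : 'M[R]_n -> 'M[R]_n) :
  class_C (@Sym R n) (@SPD R n) k T -> class_C (@Sym R n) (@SPD R n) k W ->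
  (forall S, SPD S -> SPD (T S)) -> (forall S, SPD S -> Sym (W S)) ->
  class_C (@Sym R n) (@SPD R n) k (fun S => sylvester (T S) (W S)).
Proof.
move=> Tk Wk spdT symW; have Uopen := @spd_dir_open R n.
apply: (class_C_linear_solve Uopen (f := fun S Y => T S *m Y + Y *m T S) _ Wk).
- move=> Z; have Zk := class_C_cst Uopen k Z.
  exact: (class_CD Uopen (class_C_mulmx Uopen Tk Zk) (class_C_mulmx Uopen Zk Tk)).
- move=> S _ c Y Z; rewrite mulmxDr mulmxDl -scalemxAr -scalemxAl scalerDr.
  by rewrite addrACA.
- by move=> S Z /spdT; exact: sylvester_inj.
- by move=> S spdS; apply: sylvester_eq; [exact: spdT|exact: symW].
Qed.

Lemma class_C_bures_wasserstein k (T W Z : 'M[R]_n -> 'M[R]_n) :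
  class_C (@Sym R n) (@SPD R n) k T -> class_C (@Sym R n) (@SPD R n) k W ->
  class_C (@Sym R n) (@SPD R n) k Z -> (forall S, SPD S -> SPD (T S)) ->
  (forall S, SPD S -> Sym (W S)) -> (forall S, SPD S -> Sym (Z S)) ->
  class_C (@Sym R n) (@SPD R n) k (fun S => bures_wasserstein (T S) (W S) (Z S)).
Proof.
move=> Tk Wk Zk spdT symW symZ; have Uopen := @spd_dir_open R n.
apply: (class_C_mxtrace Uopen); apply: (class_C_mulmx Uopen Tk).
by apply: (class_C_mulmx Uopen); exact: class_C_sylvester.
Qed.

Lemma power_wasserstein_smooth p X Y : Sym X -> Sym Y ->
  smooth_on (@Sym R n) (@SPD R n) (fun S => power_wasserstein p S X Y).
Proof.
move=> symX symY k; have Uopen := @spd_dir_open R n.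
have symD (W : 'M[R]_n -> 'M[R]_n) (f : R -> R -> R) Z : Sym Z ->
    (forall x y, f x y = f y x) ->
    (forall P d X', Orth P -> (forall i, 0 < d 0 i) -> X'^T = X' ->
      'D_(P *m X' *m P^T) W (P *m diag_mx d *m P^T) =
      P *m (\matrix_(i, j) (f (d 0 i) (d 0 j) * X' i j)) *m P^T) ->
    forall S, SPD S -> Sym ('D_Z W S).
  move=> symZ fC H S /spd_diagonalizable[P [d [OP d0 ->]]].
  rewrite -(orth_conjK Z OP) H//; last exact: sym_conj.
  move: (P^T *m Z *m P) (sym_conj P symZ) => Z' symZ'.
  rewrite /Sym /= !trmx_mul trmxK mulmxA; congr (_ *m _ *m _).
  by apply/matrixP => i j; rewrite !mxE fC -{1}symZ' mxE.
rewrite /power_wasserstein; case: eqVneq => [_|p0].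
  have symL Z : Sym Z -> forall S, SPD S -> Sym ('D_Z (@mxlog R n) S).
    move=> symZ; apply: (symD _ (fun x y => (expdd (ln x) (ln y))^-1)) => //.
      by move=> x y; rewrite expddC.
    move=> P d X' OP d0 symX'; rewrite derive_mxlog_spectral//.
    congr (_ *m _ *m _); apply/matrixP => i j; rewrite !mxE.
    exact: mulrC.
  apply: class_C_bures_wasserstein.
  - exact: class_C_cst.
  - by apply: (class_C_derive (f := @mxlog R n)) symX; exact: class_C_mxlog.
  - by apply: (class_C_derive (f := @mxlog R n)) symY; exact: class_C_mxlog.
  - move=> S _; have := @diag_spd R n 1%:M (const_mx 1) (orth1 R n).
    rewrite diag_const_mx mulmx1 trmx1 mulmx1; apply => i.
    by rewrite mxE.
  - exact: symL.
  - exact: symL.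
have symP Z : Sym Z -> forall S, SPD S -> Sym ('D_Z (@mxpow R n p) S).
  move=> symZ; apply: (symD _ (fun x y => p * powdd p x y)) => //.
    by move=> x y; rewrite powddC.
  by move=> P d X' OP d0 symX'; rewrite derive_mxpow_spectral.
apply: (class_CM Uopen); first exact: class_C_cst.
apply: class_C_bures_wasserstein.
- exact: class_C_mxpow.
- by apply: (class_C_derive (f := @mxpow R n p)) symX; exact: class_C_mxpow.
- by apply: (class_C_derive (f := @mxpow R n p)) symY; exact: class_C_mxpow.
- move=> S /spd_diagonalizable[P [d [OP d0 ->]]].
  by rewrite mxpowE//; apply: diag_spd => // i; rewrite mxE powR_gt0.
- exact: symP.
- exact: symP.
Qed.

Lemma power_wasserstein_riemannian p :
  riemannian_metric (@power_wasserstein R n p).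
Proof.
split.
- move=> S X Y /(power_wasserstein_eigen p)[P [d [OP d0 SE gE]]] symX symY.
  rewrite !gE//; apply: eq_bigr => i _; apply: eq_bigr => j _.
  by congr (_ / _); exact: mulrC.
- move=> S a X Y Z /(power_wasserstein_eigen p)[P [d [OP d0 SE gE]]].
  move=> symX symY symZ.
  have symXY : Sym (a *: X + Y) by rewrite /Sym /= linearD linearZ /= symX symY.
  rewrite !gE// mulr_sumr -big_split; apply: eq_bigr => i _.
  rewrite mulr_sumr -big_split; apply: eq_bigr => j _ /=.
  rewrite [P^T *m (_ + _)]mulmxDr mulmxDl -scalemxAr -scalemxAl.
  by rewrite [in LHS]mxE [in LHS]mxE; ring.
- move=> S X /(power_wasserstein_eigen p)[P [d [OP d0 SE gE]]] symX X0.
  rewrite gE//; move: X0; rewrite -{1}(orth_conjK X OP).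
  move: (P^T *m X *m P) => X' X0.
  have t0 i j : 0 <= X' i j * X' i j / pw_kernel p (d 0 i) (d 0 j).
    by rewrite divr_ge0 -?expr2 ?sqr_ge0// ltW// pw_kernel_gt0.
  have s0 i : 0 <= \sum_j X' i j * X' i j / pw_kernel p (d 0 i) (d 0 j).
    by apply: sumr_ge0 => j _; exact: t0.
  rewrite lt_neqAle sumr_ge0 ?andbT => [|i _]; last exact: s0.
  rewrite eq_sym; apply: contra X0.
  rewrite psumr_eq0 => [/allP H|i _]; last exact: s0.
  suff -> : X' = 0 by rewrite mulmx0 mul0mx.
  apply/matrixP => i j; rewrite [RHS]mxE; apply/eqP.
  have := H i (mem_index_enum i).
  rewrite /= psumr_eq0 => [/allP H'|l _]; last exact: t0.
  have := H' j (mem_index_enum j); rewrite /= mulf_eq0 invr_eq0.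
  by rewrite (gt_eqF (pw_kernel_gt0 p (d0 i) (d0 j))) orbF mulf_eq0 orbb.
- exact: power_wasserstein_smooth.
Qed.

Lemma power_wasserstein_orth_invariant p :
  orth_invariant (@power_wasserstein R n p).
Proof.
move=> Q S X Y OQ /(power_wasserstein_eigen p)[P [d [OP d0 SE gE]]] symX symY.
rewrite gE// -(power_wasserstein_spectral p (orthM OQ OP) d0
  (sym_conj P symX) (sym_conj P symY)).
have conj Z : Q *m P *m Z *m (Q *m P)^T = Q *m (P *m Z *m P^T) *m Q^T.
  by rewrite trmx_mul !mulmxA.
by rewrite !conj -SE !orth_conjK.
Qed.

Lemma power_wasserstein_has_kernel p :
  has_kernel (@power_wasserstein R n p) (@pw_kernel R p).
Proof.
move=> S X P X' d spdS symX OP SE XE.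
have d0 i : 0 < d 0 i by apply: (spd_diag_gt0 _ OP); rewrite -SE.
have symX' : X'^T = X'.
  by have := sym_conj P symX; rewrite XE orth_conjTK.
rewrite SE XE power_wasserstein_spectral//.
apply: eq_bigr => i _; apply: eq_bigr => j _.
by rewrite expr2 mul1r mulrC.
Qed.

End Metric.

Theorem theorem3p1 (R : realType) (n : nat) (p : R)
  (hn : (1 <= n)%N) (hp : p <= 1) :
  mean_kernel_metric (@power_wasserstein R n p).
Proof.
have kp := @pw_kernel_kernel_map R p.
have gp := @power_wasserstein_has_kernel R n p.
split; last by exists (@pw_kernel R p); split=> //; exact: pw_kernel_mean_form.
split; [exact: power_wasserstein_riemannian|
        exact: power_wasserstein_orth_invariant|by exists (@pw_kernel R p)].
Qed.
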